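(* Let $A$ be a non-unital C*-algebra. Then $A$ is a weakly Rickart C*-algebra if and only if every maximal abelian self-adjoint subalgebra of $A$ is monotone $\sigma$-complete.
   Context: For $x$ in a C*-algebra $A$, a projection $e\in A$ is an annihilating right projection (ARP) for $x$ if $xe=x$ and, whenever $y\in A$ satisfies $xy=0$, then $ey=0$. A C*-algebra $A$ is weakly Rickart if every $x\in A$ has an annihilating right projection in $A$. A C*-algebra $B$ is monotone $\sigma$-complete if every norm-bounded monotone increasing sequence in $B_{sa}$ has a supremum in $B_{sa}$ (for a maximal abelian self-adjoint subalgebra $M$, suprema are taken in $M_{sa}$). *)

(* Defs.v *)
From Stdlib Require Import Reals.
Open Scope R_scope.

Record Cplx := mkC { re : R; im : R }.
Definition Cadd (a b : Cplx) := mkC (re a + re b) (im a + im b).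
Definition Cmul (a b : Cplx) :=
  mkC (re a * re b - im a * im b) (re a * im b + im a * re b).
Definition Cconj (a : Cplx) := mkC (re a) (- im a).
Definition Cmod (a : Cplx) := sqrt (re a * re a + im a * im a).
Definition C1 := mkC 1 0.
Definition Cm1 := mkC (-1) 0.

Record CStarAlgebra := {
  car :> Type;
  cz : car;
  cadd : car -> car -> car;
  copp : car -> car;
  cmul : car -> car -> car;
  csmul : Cplx -> car -> car;
  cstar : car -> car;
  cnorm : car -> R;
  cadd_assoc : forall x y z, cadd x (cadd y z) = cadd (cadd x y) z;
  cadd_comm : forall x y, cadd x y = cadd y x;
  cadd_0 : forall x, cadd x cz = x;
  cadd_opp : forall x, cadd x (copp x) = cz;
  csmul_1 : forall x, csmul C1 x = x;
  csmul_assoc : forall a b x, csmul a (csmul b x) = csmul (Cmul a b) x;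
  csmul_addr : forall a x y, csmul a (cadd x y) = cadd (csmul a x) (csmul a y);
  csmul_addl : forall a b x, csmul (Cadd a b) x = cadd (csmul a x) (csmul b x);
  cmul_assoc : forall x y z, cmul x (cmul y z) = cmul (cmul x y) z;
  cmul_addr : forall x y z, cmul x (cadd y z) = cadd (cmul x y) (cmul x z);
  cmul_addl : forall x y z, cmul (cadd x y) z = cadd (cmul x z) (cmul y z);
  cmul_smull : forall a x y, cmul (csmul a x) y = csmul a (cmul x y);
  cmul_smulr : forall a x y, cmul x (csmul a y) = csmul a (cmul x y);
  cstar_invol : forall x, cstar (cstar x) = x;
  cstar_add : forall x y, cstar (cadd x y) = cadd (cstar x) (cstar y);
  cstar_smul : forall a x, cstar (csmul a x) = csmul (Cconj a) (cstar x);
  cstar_mul : forall x y, cstar (cmul x y) = cmul (cstar y) (cstar x);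
  cnorm_nonneg : forall x, 0 <= cnorm x;
  cnorm_eq0 : forall x, cnorm x = 0 -> x = cz;
  cnorm_triangle : forall x y, cnorm (cadd x y) <= cnorm x + cnorm y;
  cnorm_smul : forall a x, cnorm (csmul a x) = Cmod a * cnorm x;
  cnorm_submult : forall x y, cnorm (cmul x y) <= cnorm x * cnorm y;
  cnorm_cstar : forall x, cnorm (cmul (cstar x) x) = cnorm x * cnorm x;
  ccomplete : forall u : nat -> car,
    (forall eps, 0 < eps -> exists N, forall m n, (N <= m)%nat -> (N <= n)%nat ->
        cnorm (cadd (u m) (copp (u n))) < eps) ->
    exists l, forall eps, 0 < eps -> exists N, forall n, (N <= n)%nat ->
        cnorm (cadd (u n) (copp l)) < eps
}.

Arguments cz {c}.
Arguments cadd {c}.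
Arguments copp {c}.
Arguments cmul {c}.
Arguments csmul {c}.
Arguments cstar {c}.
Arguments cnorm {c}.

Section Defs.
Variable A : CStarAlgebra.

Definition is_projection (e : A) : Prop := cstar e = e /\ cmul e e = e.

Definition is_ARP (x e : A) : Prop :=
  is_projection e /\ cmul x e = x /\
  (forall y : A, cmul x y = cz -> cmul e y = cz).

Definition weakly_Rickart : Prop := forall x : A, exists e : A, is_ARP x e.

Definition star_subalgebra (M : A -> Prop) : Prop :=
  M cz /\
  (forall x y, M x -> M y -> M (cadd x y)) /\
  (forall a x, M x -> M (csmul a x)) /\
  (forall x y, M x -> M y -> M (cmul x y)) /\
  (forall x, M x -> M (cstar x)).

Definition abelian (M : A -> Prop) : Prop :=
  forall x y, M x -> M y -> cmul x y = cmul y x.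

Definition is_masa (M : A -> Prop) : Prop :=
  star_subalgebra M /\ abelian M /\
  (forall N : A -> Prop, star_subalgebra N -> abelian N ->
     (forall x, M x -> N x) -> forall x, N x -> M x).

(* Order of the C*-algebra M (positive cone of M = {w* w | w in M}):
   x <= y in M iff y - x = w* w for some w in M. *)
Definition le_in (M : A -> Prop) (x y : A) : Prop :=
  exists w, M w /\ cadd y (copp x) = cmul (cstar w) w.

Definition self_adjoint_in (M : A -> Prop) (x : A) : Prop := M x /\ cstar x = x.

Definition monotone_sigma_complete (M : A -> Prop) : Prop :=
  forall u : nat -> A,
    (forall n, self_adjoint_in M (u n)) ->
    (exists K, forall n, cnorm (u n) <= K) ->
    (forall n, le_in M (u n) (u (S n))) ->
    exists s, self_adjoint_in M s /\
      (forall n, le_in M (u n) s) /\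
      (forall t, self_adjoint_in M t -> (forall n, le_in M (u n) t) -> le_in M s t).

End Defs.

(* Main.v *)
(* Let B be the real Banach algebra of self-adjoint elements of a masa M, and T its unitization.
   In T the inequality |x|^2 <= |x^2 + y^2| holds and 1 - h has a square root for |h| <= 1, so the
   squares form a closed cone and positive parts exist; this replaces the Gelfand representation.

   If A is weakly Rickart, the annihilating projection of an element of M commutes with M, hence
   lies in M.  The supremum of an increasing sequence 0 <= u_n <= 1 in M is then assembled from
   its binary digits: the leading digit is the range projection of the positive parts of the
   u_n - 1/2, and the remainder is again an increasing sequence between 0 and 1.

   Conversely, in a monotone sigma-complete masa containing a scaled h = b^2, the supremum of
   1 - (1-h)^n is the range projection of b relative to the masa.  For b = x* x the masa is chosen
   to contain a maximal commuting set of self-adjoint elements annihilated by b; maximality makes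
   the projection annihilate every y in A with x y = 0. *)

Require Import Defs.
From Stdlib Require Import Reals Lra Lia Ring Classical ClassicalEpsilon ProofIrrelevance.
From mathcomp Require classical_sets.

(** * Unital function algebras with a distinguished character *)

(** The elements 1 - e, 1 - (1-h)^n and u_n - 1/2 need a unit that M may lack. The arguments
    therefore take place in T, and [chi] records what falls back into M: suprema and projections
    must come out with [chi = 0], while the elements tested against them may have a scalar part.
    Real scalars suffice because w* w is a sum of two squares of commuting self-adjoint elements, so
    the order of M becomes a statement about squares. Among these axioms [nm_sq] is the trace of the
    C*-identity: it excludes nilpotents, bounds roots and makes the order antisymmetric, while
    completeness produces the roots. Binary digits enter because annihilating projections supply
    only projections: suprema of general elements have to be norm limits of combinations of
    these. *)

(* An abstract form of the unitization of the self-adjoint part of a commutative C*-algebra: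
   [scal] embeds the scalars and the kernel of [chi] is the original algebra. *)
Record AugAlgebra := {
  aug :> Type;
  azero : aug;
  aone : aug;
  aadd : aug -> aug -> aug;
  amul : aug -> aug -> aug;
  asub : aug -> aug -> aug;
  aopp : aug -> aug;
  aug_ring : ring_theory azero aone aadd amul asub aopp eq;
  scal : R -> aug;
  scal_add : forall r s, scal (r + s) = aadd (scal r) (scal s);
  scal_mul : forall r s, scal (r * s) = amul (scal r) (scal s);
  scal_1 : scal 1 = aone;
  nm : aug -> R;
  nm_ge0 : forall x, 0 <= nm x;
  nm_eq0 : forall x, nm x = 0 -> x = azero;
  nm_triangle : forall x y, nm (aadd x y) <= nm x + nm y;
  nm_mul : forall x y, nm (amul x y) <= nm x * nm y;
  nm_scal : forall r, nm (scal r) <= Rabs r;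
  nm_sq : forall x y, nm x * nm x <= nm (aadd (amul x x) (amul y y));
  aug_complete : forall u : nat -> aug,
    (forall eps, 0 < eps -> exists N, forall m n, (N <= m)%nat -> (N <= n)%nat ->
        nm (asub (u m) (u n)) < eps) ->
    exists l, forall eps, 0 < eps -> exists N, forall n, (N <= n)%nat ->
        nm (asub (u n) l) < eps;
  chi : aug -> R;
  chi_add : forall x y, chi (aadd x y) = chi x + chi y;
  chi_mul : forall x y, chi (amul x y) = chi x * chi y;
  chi_scal : forall r, chi (scal r) = r;
  chi_nm : forall x, Rabs (chi x) <= nm x
}.

Arguments azero {a}.
Arguments aone {a}.
Arguments aadd {a}.
Arguments amul {a}.
Arguments asub {a}.
Arguments aopp {a}.
Arguments scal {a}.
Arguments nm {a}.
Arguments chi {a}.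

Section Positivity.
Variable T : AugAlgebra.
Add Ring T_ring : (aug_ring T).

Declare Scope T_scope.
Delimit Scope T_scope with T.
Local Notation "0" := (@azero T) : T_scope.
Local Notation "1" := (@aone T) : T_scope.
Local Notation "x + y" := (@aadd T x y) : T_scope.
Local Notation "x * y" := (@amul T x y) : T_scope.
Local Notation "x - y" := (@asub T x y) : T_scope.
Local Notation "- x" := (@aopp T x) : T_scope.
Implicit Types x y z h p q u v w e s t : T.

(** * Real scalars and the norm *)

Lemma scal_0 : scal 0 = 0%T.
Proof.
  assert (H : (scal 0 + scal 0 = scal 0)%T) by (rewrite <- scal_add; f_equal; ring).
  replace (scal 0) with (scal 0 + scal 0 - scal 0)%T by ring.
  rewrite H. ring.
Qed.

Lemma scal_opp r : scal (- r) = (- scal r)%T.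
Proof.
  assert (H : (scal (- r) + scal r = 0)%T)
    by (rewrite <- scal_add, Rplus_opp_l; apply scal_0).
  replace (scal (- r)) with (scal (- r) + scal r - scal r)%T by ring.
  rewrite H. ring.
Qed.

Lemma scal_sub (r s : R) : scal (r - s) = (scal r - scal s)%T.
Proof. unfold Rminus. rewrite scal_add, scal_opp. ring. Qed.

Lemma scal_half2 x : (scal (1 / 2) * x + scal (1 / 2) * x = x)%T.
Proof.
  replace (scal (1 / 2) * x + scal (1 / 2) * x)%T
    with ((scal (1 / 2) + scal (1 / 2)) * x)%T by ring.
  rewrite <- scal_add. replace (1 / 2 + 1 / 2) with 1 by field. rewrite scal_1. ring.
Qed.

Lemma scal_K r x : r <> 0 -> (scal r * (scal (/ r) * x) = x)%T.
Proof.
  intros Hr. replace (scal r * (scal (/ r) * x))%T with (scal r * scal (/ r) * x)%T by ring.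
  rewrite <- scal_mul, Rinv_r, scal_1 by assumption. ring.
Qed.

Lemma nm_0 : nm (0%T : T) = 0.
Proof.
  pose proof (nm_scal T 0) as H. rewrite scal_0, Rabs_R0 in H.
  pose proof (nm_ge0 T 0%T). lra.
Qed.

Lemma nm_1 : nm (1%T : T) <= 1.
Proof. pose proof (nm_scal T 1) as H. rewrite scal_1, Rabs_R1 in H. exact H. Qed.

Lemma nm_scal_mul r x : 0 <= r -> nm (scal r * x)%T <= r * nm x.
Proof.
  intros Hr. eapply Rle_trans; [apply nm_mul|].
  pose proof (nm_scal T r) as H. rewrite Rabs_pos_eq in H by assumption.
  apply Rmult_le_compat_r; [apply nm_ge0 | exact H].
Qed.

Lemma nm_opp_le x : nm (- x)%T <= nm x.
Proof.
  replace (- x)%T with (scal (- (1)) * x)%T by (rewrite scal_opp, scal_1; ring).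
  eapply Rle_trans; [apply nm_mul|].
  pose proof (nm_scal T (- (1))) as H. rewrite Rabs_Ropp, Rabs_R1 in H.
  pose proof (nm_ge0 T x). nra.
Qed.

Lemma nm_opp x : nm (- x)%T = nm x.
Proof.
  apply Rle_antisym; [apply nm_opp_le|].
  replace x with (- - x)%T at 1 by ring. apply nm_opp_le.
Qed.

Lemma nm_sub x y : nm (x - y)%T <= nm x + nm y.
Proof.
  replace (x - y)%T with (x + - y)%T by ring. rewrite <- (nm_opp y). apply nm_triangle.
Qed.

Lemma nm_subC x y : nm (x - y)%T = nm (y - x)%T.
Proof. rewrite <- nm_opp. f_equal. ring. Qed.

Lemma nm_dist x y z : nm (x - z)%T <= nm (x - y)%T + nm (y - z)%T.
Proof. replace (x - z)%T with (x - y + (y - z))%T by ring. apply nm_triangle. Qed.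

Lemma nm_small x : (forall eps, 0 < eps -> nm x <= eps) -> x = 0%T.
Proof.
  intros H. apply nm_eq0. pose proof (nm_ge0 T x).
  destruct (Rle_lt_dec (nm x) 0); [lra|].
  specialize (H (nm x / 2) ltac:(lra)). lra.
Qed.

(** * Squares, and square roots near the unit by iteration *)

Lemma nm_sq_root x : nm x * nm x <= nm (x * x)%T.
Proof.
  replace (x * x)%T with (x * x + 0 * 0)%T by ring. apply nm_sq.
Qed.

(** Reducedness stands in for pointwise evaluation: orthogonality of two elements is repeatedly
    derived from the vanishing of products with squares. *)
Lemma sq_eq0 x : (x * x = 0)%T -> x = 0%T.
Proof.
  intros H. apply nm_eq0. pose proof (nm_sq_root x) as H1. rewrite H, nm_0 in H1.
  pose proof (nm_ge0 T x). nra.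
Qed.

(* The scalar iteration q' = (1 + q^2)/2 dominates the iteration
   p' = (h + p^2)/2 in the algebra, whose fixed point solves (1 - p)^2 = 1 - h. *)
Fixpoint majorant (n : nat) : R :=
  match n with O => 0 | S m => (1 + majorant m * majorant m) / 2 end.

Fixpoint iterate h (n : nat) : T :=
  match n with
  | O => 0%T
  | S m => (scal (1 / 2) * (h + iterate h m * iterate h m))%T
  end.

Lemma majorant_bounds n : 0 <= majorant n <= 1.
Proof. induction n as [|n IH]; simpl; [lra | nra]. Qed.

Lemma majorant_step n : majorant n <= majorant (S n).
Proof. pose proof (majorant_bounds n). simpl. nra. Qed.

Lemma majorant_cauchy : Cauchy_crit majorant.
Proof.
  apply CV_Cauchy. apply growing_cv.
  - intros n. apply majorant_step.
  - exists 1. intros r [n ->]. apply majorant_bounds.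
Qed.

Lemma iterate_bound h n : nm h <= 1 -> nm (iterate h n) <= majorant n.
Proof.
  intros Hh. induction n as [|n IH]; simpl.
  - rewrite nm_0. lra.
  - eapply Rle_trans; [apply nm_scal_mul; lra|].
    pose proof (nm_triangle T h (iterate h n * iterate h n)%T).
    pose proof (nm_mul T (iterate h n) (iterate h n)).
    pose proof (nm_ge0 T (iterate h n)). nra.
Qed.

(** Consecutive differences factor as (a + b)(a - b)/2, and the scalar increments satisfy the same
    identity, so they dominate. *)
Lemma iterate_step h n : nm h <= 1 ->
  nm (iterate h (S n) - iterate h n)%T <= majorant (S n) - majorant n.
Proof.
  intros Hh. induction n as [|n IH].
  - simpl. replace (scal (1 / 2) * (h + 0 * 0) - 0)%T with (scal (1 / 2) * h)%T by ring.
    eapply Rle_trans; [apply nm_scal_mul; lra | lra].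
  - set (a := iterate h (S n)) in *. set (b := iterate h n) in *.
    replace (iterate h (S (S n)) - a)%T with (scal (1 / 2) * ((a + b) * (a - b)))%T
      by (unfold a, b; simpl; ring).
    pose proof (nm_scal_mul (1 / 2) ((a + b) * (a - b))%T ltac:(lra)) as H1.
    pose proof (nm_mul T (a + b)%T (a - b)%T) as H2.
    pose proof (nm_triangle T a b) as H3.
    pose proof (iterate_bound h (S n) Hh) as H4. fold a in H4.
    pose proof (iterate_bound h n Hh) as H5. fold b in H5.
    pose proof (nm_ge0 T (a + b)%T). pose proof (nm_ge0 T (a - b)%T).
    assert (H6 : nm (a + b)%T * nm (a - b)%T
      <= (majorant (S n) + majorant n) * (majorant (S n) - majorant n))
      by (apply Rmult_le_compat; lra).
    change (majorant (S (S n))) with ((1 + majorant (S n) * majorant (S n)) / 2).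
    assert (E : majorant (S n) = (1 + majorant n * majorant n) / 2) by reflexivity.
    lra.
Qed.

Lemma iterate_dist h n k : nm h <= 1 ->
  nm (iterate h (n + k) - iterate h n)%T <= majorant (n + k) - majorant n.
Proof.
  intros Hh. induction k as [|k IH].
  - rewrite Nat.add_0_r. replace (iterate h n - iterate h n)%T with 0%T by ring.
    rewrite nm_0. lra.
  - rewrite Nat.add_succ_r. pose proof (iterate_step h (n + k) Hh).
    pose proof (nm_dist (iterate h (S (n + k))) (iterate h (n + k)) (iterate h n)). lra.
Qed.

(** Comparison with a bounded increasing scalar sequence gives convergence even at [nm h = 1], where
    no geometric rate is available. The bound [nm p <= 1] is recorded because it makes the root
    [1 - p] positive. *)
Lemma sqrt_near_one h : nm h <= 1 ->
  exists p, nm p <= 1 /\ ((1 - p) * (1 - p) = 1 - h)%T.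
Proof.
  intros Hh.
  destruct (aug_complete T (iterate h)) as [p Hp].
  - intros eps Heps. destruct (majorant_cauchy eps Heps) as [N HN]. exists N.
    assert (H : forall m n, (N <= n)%nat -> (n <= m)%nat ->
      nm (iterate h m - iterate h n)%T < eps).
    { intros m n Hn Hm. replace m with (n + (m - n))%nat by lia.
      eapply Rle_lt_trans; [apply iterate_dist; exact Hh|].
      specialize (HN (n + (m - n))%nat n ltac:(lia) Hn).
      unfold Rdist in HN. apply Rabs_def2 in HN. lra. }
    intros m n Hm Hn. destruct (Nat.le_ge_cases n m).
    + apply H; assumption.
    + rewrite nm_subC. apply H; assumption.
  - assert (Hp1 : nm p <= 1).
    { apply Rnot_lt_le. intros Hlt.
      destruct (Hp (nm p - 1) ltac:(lra)) as [N HN]. specialize (HN N (le_n N)).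
      pose proof (iterate_bound h N Hh). pose proof (majorant_bounds N).
      pose proof (nm_triangle T (iterate h N) (p - iterate h N)%T) as H1.
      replace (iterate h N + (p - iterate h N))%T with p in H1 by ring.
      rewrite (nm_subC p) in H1. lra. }
    exists p. split; [exact Hp1|].
    (* The residual of [p] is [p - iterate h (S N)] plus half of (a + p)(a - p) with a =
       [iterate h N]; both tend to zero. *)
    assert (Hfix : (p - scal (1 / 2) * (h + p * p) = 0)%T).
    { apply nm_small. intros eps Heps.
      destruct (Hp (eps / 2) ltac:(lra)) as [N HN].
      pose proof (HN (S N) ltac:(lia)) as H1. pose proof (HN N (le_n N)) as H2.
      set (a := iterate h N) in *.
      replace (p - scal (1 / 2) * (h + p * p))%T
        with (p - iterate h (S N) + scal (1 / 2) * ((a + p) * (a - p)))%T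
        by (unfold a; simpl; ring).
      eapply Rle_trans; [apply nm_triangle|]. rewrite (nm_subC p).
      pose proof (nm_scal_mul (1 / 2) ((a + p) * (a - p))%T ltac:(lra)) as H3.
      pose proof (nm_mul T (a + p)%T (a - p)%T) as H4.
      pose proof (nm_triangle T a p) as H5.
      pose proof (iterate_bound h N Hh) as H6. fold a in H6.
      pose proof (majorant_bounds N). pose proof (nm_ge0 T (a - p)%T).
      assert (nm (a + p)%T * nm (a - p)%T <= 2 * nm (a - p)%T)
        by (apply Rmult_le_compat_r; lra).
      lra. }
    replace ((1 - p) * (1 - p))%T with (1 - (p + p) + p * p)%T by ring.
    replace p with (scal (1 / 2) * (h + p * p))%T at 1 2.
    + rewrite scal_half2. ring.
    + replace p with (p - scal (1 / 2) * (h + p * p) + scal (1 / 2) * (h + p * p))%T at 3 by ring.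
      rewrite Hfix. ring.
Qed.

(** * The cone of squares and its order *)

Definition pos x : Prop := exists y, x = (y * y)%T.
Definition ale x y : Prop := pos (y - x)%T.
Local Notation "x <=t y" := (ale x y) (at level 70).

Lemma pos_sq x : pos (x * x)%T.
Proof. exists x. reflexivity. Qed.

Lemma pos_mul x y : pos x -> pos y -> pos (x * y)%T.
Proof. intros [a ->] [b ->]. exists (a * b)%T. ring. Qed.

Lemma pos_scal r : 0 <= r -> pos (scal r).
Proof. intros Hr. exists (scal (sqrt r)). rewrite <- scal_mul, sqrt_sqrt by exact Hr. reflexivity. Qed.

Lemma pos_0 : pos 0%T.
Proof. exists 0%T. ring. Qed.

Lemma pos_1 : pos 1%T.
Proof. exists 1%T. ring. Qed.

Lemma pos_scal_mul r x : 0 <= r -> pos x -> pos (scal r * x)%T.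
Proof. intros Hr. apply pos_mul, pos_scal, Hr. Qed.

Lemma pos_unscal r x : 0 < r -> pos (scal r * x)%T -> pos x.
Proof.
  intros Hr H. rewrite <- (scal_K (/ r) x) by (apply Rinv_neq_0_compat; lra).
  rewrite Rinv_inv. apply pos_scal_mul; [left; apply Rinv_0_lt_compat|]; assumption.
Qed.

(** With the converse [pos_near_one], positivity in the unit ball becomes |1 - x| <= 1, a convex and
    closed condition through which sums and limits of squares are handled. *)
Lemma pos_of_near_one x : nm (1 - x)%T <= 1 -> pos x.
Proof.
  intros H. destruct (sqrt_near_one (1 - x)%T H) as (p & _ & Hp).
  exists (1 - p)%T. rewrite Hp. ring.
Qed.

(* With q^2 = 1 - h^2, the inequality |q|^2 <= |q^2 + h^2| = |1| bounds q. *)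
Lemma sq_near_one h : nm h <= 1 -> nm (1 - h * h)%T <= 1.
Proof.
  intros Hh. pose proof (nm_ge0 T h).
  destruct (sqrt_near_one (h * h)%T) as (p & _ & Hp).
  { pose proof (nm_mul T h h). nra. }
  rewrite <- Hp. pose proof (nm_sq T (1 - p)%T h) as H1. rewrite Hp in H1.
  replace (1 - h * h + h * h)%T with 1%T in H1 by ring.
  pose proof nm_1. pose proof (nm_mul T (1 - p)%T (1 - p)%T). lra.
Qed.

Lemma pos_near_one x : pos x -> nm x <= 1 -> nm (1 - x)%T <= 1.
Proof.
  intros [y ->] H. apply sq_near_one. pose proof (nm_sq_root y).
  pose proof (nm_ge0 T y). nra.
Qed.

Lemma nm_rescale r x : nm x <= r -> 0 < r -> nm (scal (/ r) * x)%T <= 1.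
Proof.
  intros H Hr. pose proof (Rinv_0_lt_compat r Hr).
  eapply Rle_trans; [apply nm_scal_mul; lra|].
  rewrite <- (Rinv_l r) by lra. apply Rmult_le_compat_l; lra.
Qed.

(** Once scaled into the unit ball, each square lies within distance 1 of the unit, hence so does
    their average. *)
Lemma pos_add x y : pos x -> pos y -> pos (x + y)%T.
Proof.
  intros [a ->] [b ->]. set (K := 1 + nm a + nm b).
  pose proof (nm_ge0 T a). pose proof (nm_ge0 T b).
  assert (HK : 0 < K) by (unfold K; lra).
  set (a' := (scal (/ K) * a)%T). set (b' := (scal (/ K) * b)%T).
  pose proof (sq_near_one a' (nm_rescale K a ltac:(unfold K; lra) HK)) as Ha.
  pose proof (sq_near_one b' (nm_rescale K b ltac:(unfold K; lra) HK)) as Hb.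
  rewrite <- (scal_K K a), <- (scal_K K b) by lra. fold a' b'.
  replace (scal K * a' * (scal K * a') + scal K * b' * (scal K * b'))%T
    with (scal K * scal K * (a' * a' + b' * b'))%T by ring.
  apply pos_mul; [apply pos_sq|].
  apply (pos_unscal (1 / 2)); [lra|]. apply pos_of_near_one.
  replace (1 - scal (1 / 2) * (a' * a' + b' * b'))%T
    with (scal (1 / 2) * (1 - a' * a' + (1 - b' * b')))%T.
  - eapply Rle_trans; [apply nm_scal_mul; lra|].
    pose proof (nm_triangle T (1 - a' * a')%T (1 - b' * b')%T). lra.
  - rewrite <- (scal_half2 1%T) at 3. ring.
Qed.

Lemma pos_antisym x : pos x -> pos (- x)%T -> x = 0%T.
Proof.
  intros [a Ha] [b Hb]. pose proof (nm_sq T a b) as H.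
  rewrite <- Ha, <- Hb in H. replace (x + - x)%T with 0%T in H by ring. rewrite nm_0 in H.
  assert (a = 0%T) as -> by (apply nm_eq0; pose proof (nm_ge0 T a); nra).
  rewrite Ha. ring.
Qed.

Lemma pos_sum0 x y : pos x -> pos y -> (x + y = 0)%T -> x = 0%T.
Proof.
  intros Hx Hy H. apply pos_antisym; [exact Hx|].
  replace (- x)%T with (x + y - x - x + x)%T by (rewrite H; ring).
  replace (x + y - x - x + x)%T with y by ring. exact Hy.
Qed.

Lemma pos_archimedean x : (forall eps, 0 < eps -> pos (x + scal eps)%T) -> pos x.
Proof.
  intros H. set (K := nm x + 1). pose proof (nm_ge0 T x).
  assert (HK : 0 < K) by (unfold K; lra).
  pose proof (Rinv_0_lt_compat K HK).
  apply (pos_unscal (/ K)); [assumption|]. apply pos_of_near_one.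
  apply Rle_plus_epsilon. intros d Hd.
  (* The bound 1 keeps [x + scal eps] of norm at most [K]; the bound [K * d] makes the correction,
     divided by [K], at most [d]. *)
  set (eps := Rmin 1 (K * d)).
  assert (Heps : 0 < eps) by (unfold eps; apply Rmin_pos; nra).
  assert (Hle1 : eps <= 1) by apply Rmin_l.
  assert (Hle2 : eps <= K * d) by apply Rmin_r.
  specialize (H eps Heps).
  pose proof (nm_scal T eps) as H2. rewrite Rabs_pos_eq in H2 by lra.
  pose proof (pos_near_one (scal (/ K) * (x + scal eps))%T
    ltac:(apply pos_scal_mul; [lra|exact H])) as H3.
  assert (H4 : nm (x + scal eps)%T <= K).
  { eapply Rle_trans; [apply nm_triangle|]. unfold K. lra. }
  specialize (H3 (nm_rescale K _ H4 HK)).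
  replace (1 - scal (/ K) * x)%T
    with (1 - scal (/ K) * (x + scal eps) + scal (/ K) * scal eps)%T by ring.
  eapply Rle_trans; [apply nm_triangle|].
  pose proof (nm_scal_mul (/ K) (scal eps) ltac:(lra)).
  assert (/ K * nm (scal eps : T) <= d).
  { apply Rmult_le_reg_l with K; [exact HK|].
    rewrite <- Rmult_assoc, Rinv_r by lra. lra. }
  lra.
Qed.

Lemma nm_ale r x : nm x <= r -> x <=t scal r.
Proof.
  intros H. destruct (Req_dec r 0) as [->|Hr].
  - assert (x = 0%T) as -> by (apply nm_eq0; pose proof (nm_ge0 T x); lra).
    unfold ale. rewrite scal_0. replace (0 - 0)%T with 0%T by ring. apply pos_0.
  - assert (0 < r) by (pose proof (nm_ge0 T x); lra).
    pose proof (Rinv_0_lt_compat r ltac:(assumption)).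
    apply (pos_unscal (/ r)); [assumption|]. apply pos_of_near_one.
    replace (scal (/ r) * (scal r - x))%T with (scal (/ r) * scal r - scal (/ r) * x)%T by ring.
    rewrite <- scal_mul, Rinv_l, scal_1 by lra.
    replace (1 - (1 - scal (/ r) * x))%T with (scal (/ r) * x)%T by ring.
    apply nm_rescale; assumption.
Qed.

Lemma ale_nm x : pos x -> x <=t 1%T -> nm x <= 1.
Proof.
  intros [a ->] [b Hb]. pose proof (nm_sq T a b) as H. rewrite <- Hb in H.
  replace (a * a + (1 - a * a))%T with 1%T in H by ring.
  pose proof nm_1. pose proof (nm_mul T a a). lra.
Qed.

Lemma ale_refl x : x <=t x.
Proof. unfold ale. replace (x - x)%T with 0%T by ring. apply pos_0. Qed.

Lemma ale_trans x y z : x <=t y -> y <=t z -> x <=t z.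
Proof.
  unfold ale. intros H1 H2. replace (z - x)%T with (y - x + (z - y))%T by ring.
  apply pos_add; assumption.
Qed.

Lemma pos_ale x y : pos x -> x <=t y -> pos y.
Proof. intros H1 H2. replace y with (x + (y - x))%T by ring. apply pos_add; assumption. Qed.

Lemma pos_limit x : (forall eps, 0 < eps -> exists y, pos y /\ nm (y - x)%T <= eps) -> pos x.
Proof.
  intros H. apply pos_archimedean. intros eps Heps.
  destruct (H eps Heps) as (y & Hy & Hd). apply (pos_ale y); [exact Hy|].
  unfold ale. replace (x + scal eps - y)%T with (scal eps - (y - x))%T by ring.
  apply nm_ale, Hd.
Qed.

(** * Positive roots and positive parts *)

(** The given root [y] has no definite sign. The iteration yields another root K(1 - p) with |p| <=
    1, which is positive. *)
Lemma pos_root x : pos x -> exists r, pos r /\ x = (r * r)%T.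
Proof.
  intros [y ->]. pose proof (nm_ge0 T y).
  set (K := 1 + nm y). assert (HK : 0 < K) by (unfold K; lra).
  set (y' := (scal (/ K) * y)%T).
  destruct (sqrt_near_one (1 - y' * y')%T) as (p & Hp1 & Hp).
  { apply sq_near_one, nm_rescale; [unfold K; lra | exact HK]. }
  exists (scal K * (1 - p))%T. split.
  - apply pos_scal_mul; [lra|]. apply pos_of_near_one.
    replace (1 - (1 - p))%T with p by ring. exact Hp1.
  - replace (scal K * (1 - p) * (scal K * (1 - p)))%T
      with (scal K * scal K * ((1 - p) * (1 - p)))%T by ring.
    rewrite Hp, <- (scal_K K y) by lra. fold y'. ring.
Qed.

Lemma cube_eq0 x : (x * x * x = 0)%T -> x = 0%T.
Proof.
  intros H. apply sq_eq0, sq_eq0. replace (x * x * (x * x))%T with (x * x * x * x)%T by ring.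
  rewrite H. ring.
Qed.

(** For d = x - y the positive elements d^2 x and d^2 y sum to d(x^2 - y^2) = 0, so both vanish, and
    d^3 is their difference. *)
Lemma pos_root_unique x y : pos x -> pos y -> (x * x = y * y)%T -> x = y.
Proof.
  intros Hx Hy H. set (d := (x - y)%T).
  assert (H0 : (d * d * x + d * d * y = 0)%T).
  { unfold d. replace ((x - y) * (x - y) * x + (x - y) * (x - y) * y)%T
      with ((x - y) * (x * x - y * y))%T by ring. rewrite H. ring. }
  assert (Hdx : (d * d * x = 0)%T).
  { eapply pos_sum0; [| |exact H0]; apply pos_mul; try apply pos_sq; assumption. }
  assert (Hdy : (d * d * y = 0)%T).
  { rewrite Hdx in H0. rewrite <- H0. ring. }
  assert (d = 0%T).
  { apply cube_eq0. replace (d * d * d)%T with (d * d * x - d * d * y)%T by (unfold d; ring).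
    rewrite Hdx, Hdy. ring. }
  replace x with (d + y)%T by (unfold d; ring). rewrite H1. ring.
Qed.

(** With m = |x|, the candidates are m + x and m - x, halved. Their positivity is the difficulty:
    let a, b be the positive roots of their squares. Since y z = 0 and a b = 0, the positive
    elements a + b and y + z = 2m have equal squares, so they coincide; orthogonality then separates
    them into y = a and z = b. *)
Lemma pos_part_exists x :
  exists y, exists z, pos y /\ pos z /\ x = (y - z)%T /\ (y * z = 0)%T.
Proof.
  destruct (pos_root (x * x)%T (pos_sq x)) as (m & Hm & Hxm).
  set (y := (m + x)%T). set (z := (m - x)%T).
  assert (Hyz : (y * z = 0)%T).
  { unfold y, z. replace ((m + x) * (m - x))%T with (m * m - x * x)%T by ring.
    rewrite Hxm. ring. }
  destruct (pos_root (y * y)%T (pos_sq y)) as (a & Ha & Hya).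
  destruct (pos_root (z * z)%T (pos_sq z)) as (b & Hb & Hzb).
  assert (Hab : (a * b = 0)%T).
  { apply sq_eq0. replace (a * b * (a * b))%T with (a * a * (b * b))%T by ring.
    rewrite <- Hya, <- Hzb. replace (y * y * (z * z))%T with (y * z * (y * z))%T by ring.
    rewrite Hyz. ring. }
  assert (Hay : (a * z = 0)%T).
  { apply sq_eq0. replace (a * z * (a * z))%T with (a * a * (z * z))%T by ring.
    rewrite Hzb. replace (a * a * (b * b))%T with (a * b * (a * b))%T by ring.
    rewrite Hab. ring. }
  assert (Hby : (b * y = 0)%T).
  { apply sq_eq0. replace (b * y * (b * y))%T with (b * b * (y * y))%T by ring.
    rewrite Hya. replace (b * b * (a * a))%T with (a * b * (a * b))%T by ring.
    rewrite Hab. ring. }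
  assert (Hsum : (a + b = y + z)%T).
  { apply pos_root_unique.
    - apply pos_add; assumption.
    - replace (y + z)%T with (m + m)%T by (unfold y, z; ring). apply pos_add; assumption.
    - replace ((a + b) * (a + b))%T with (a * a + b * b + (a * b + a * b))%T by ring.
      replace ((y + z) * (y + z))%T with (y * y + z * z + (y * z + y * z))%T by ring.
      rewrite Hyz, Hab, <- Hya, <- Hzb. ring. }
  assert (Hy : y = a).
  { assert (H : (a - y = 0)%T).
    { apply sq_eq0.
      replace ((a - y) * (a - y))%T with (a * a + y * y - a * y - a * y)%T by ring.
      replace (a * y)%T with (a * (y + z))%T.
      - rewrite <- Hsum, Hya. replace (a * (a + b))%T with (a * a + a * b)%T by ring.
        rewrite Hab. ring.
      - replace (a * (y + z))%T with (a * y + a * z)%T by ring. rewrite Hay. ring. }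
    replace y with (a - (a - y))%T by ring. rewrite H. ring. }
  assert (Hz : z = b).
  { replace z with (y + z - y)%T by ring. rewrite <- Hsum, Hy. ring. }
  exists (scal (1 / 2) * y)%T, (scal (1 / 2) * z)%T.
  split; [apply pos_scal_mul; [lra | rewrite Hy; exact Ha]|].
  split; [apply pos_scal_mul; [lra | rewrite Hz; exact Hb]|].
  split.
  - unfold y, z. rewrite <- (scal_half2 x) at 1. ring.
  - replace (scal (1 / 2) * y * (scal (1 / 2) * z))%T
      with (scal (1 / 2) * scal (1 / 2) * (y * z))%T by ring.
    rewrite Hyz. ring.
Qed.

(** * The character, and range projections as suprema *)

Lemma chi_0 : chi (0%T : T) = 0.
Proof. rewrite <- scal_0. apply chi_scal. Qed.

Lemma chi_1 : chi (1%T : T) = 1.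
Proof. rewrite <- scal_1. apply chi_scal. Qed.

Lemma chi_sub x y : chi (x - y)%T = chi x - chi y.
Proof.
  replace (x - y)%T with (x + scal (- (1)) * y)%T by (rewrite scal_opp, scal_1; ring).
  rewrite chi_add, chi_mul, chi_scal. ring.
Qed.

Lemma chi_pos x : pos x -> 0 <= chi x.
Proof. intros [y ->]. rewrite chi_mul. nra. Qed.

(** Sequence, supremum and competing bounds all lie in the kernel of [chi], the copy of the original
    algebra. *)
Definition aug_sigma_complete : Prop :=
  forall u : nat -> T,
    (forall n, chi (u n) = 0) ->
    (exists K, forall n, nm (u n) <= K) ->
    (forall n, u n <=t u (S n)) ->
    exists s, chi s = 0 /\ (forall n, u n <=t s) /\
      (forall t, chi t = 0 -> (forall n, u n <=t t) -> s <=t t).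

(** Here [y] ranges over the whole unital algebra: it will be the negative part of some t - 1/2,
    which may have a scalar part. *)
Definition aug_ARP x e : Prop :=
  chi e = 0 /\ (e * e = e)%T /\ (x * e = x)%T /\ (forall y, (x * y = 0)%T -> (e * y = 0)%T).

Fixpoint apow x (n : nat) : T :=
  match n with O => 1%T | S m => (x * apow x m)%T end.

Lemma pos_apow x n : pos x -> pos (apow x n).
Proof. intros Hx. induction n; simpl; [apply pos_1 | apply pos_mul; assumption]. Qed.

(** The telescoping sum 1 - (1-h)^n = h + h(1-h) + ... has n terms, each at least h(1-h)^n. *)
Lemma apow_bernoulli h n : pos h -> pos (1 - h)%T ->
  pos (1 - apow (1 - h) n - scal (INR n) * (h * apow (1 - h) n))%T.
Proof.
  intros Hh H1. induction n as [|n IH].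
  - simpl. rewrite scal_0. replace (1 - 1 - 0 * (h * 1))%T with 0%T by ring. apply pos_0.
  - rewrite S_INR, scal_add, scal_1. simpl apow.
    set (v := apow (1 - h)%T n) in *.
    assert (Hv : pos v) by (apply pos_apow; exact H1).
    replace (1 - (1 - h) * v - (scal (INR n) + 1) * (h * ((1 - h) * v)))%T
      with (1 - v - scal (INR n) * (h * v)
            + (scal (INR n) * (h * h * v) + h * h * v))%T by ring.
    apply pos_add; [exact IH|].
    assert (pos (h * h * v)%T) by (repeat apply pos_mul; assumption).
    apply pos_add; [apply pos_scal_mul; [apply pos_INR|]|]; assumption.
Qed.

Lemma pos_diff0 x y : pos x -> x <=t y -> y = 0%T -> x = 0%T.
Proof.
  intros Hx Hy E. apply pos_antisym; [exact Hx|]. unfold ale in Hy. rewrite E in Hy.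
  replace (- x)%T with (0 - x)%T by ring. exact Hy.
Qed.

(** Annihilation is insensitive to nonzero scaling, so [s] may be moved into the unit ball; the last
    clause undoes the scaling. *)
Lemma pos_scaled_sq s : exists r, 0 < r /\ nm (scal r * s)%T <= 1 /\
  forall x, (x * (scal r * s) = 0)%T -> (x * s = 0)%T.
Proof.
  exists (/ (1 + nm s)). pose proof (nm_ge0 T s).
  assert (0 < / (1 + nm s)) by (apply Rinv_0_lt_compat; lra).
  split; [assumption|]. split; [apply nm_rescale; lra|].
  intros x H1. rewrite <- (scal_K (1 + nm s) s) by lra.
  replace (x * (scal (1 + nm s) * (scal (/ (1 + nm s)) * s)))%T
    with (scal (1 + nm s) * (x * (scal (/ (1 + nm s)) * s)))%T by ring.
  rewrite H1. ring.
Qed.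

(* For 0 <= h <= 1 the supremum e of u_n = 1 - (1-h)^n is the range projection of h.
   Perturbing e produces further upper bounds: e - e k when h k = 0, whence e k = 0;
   and e + h (1 - e), whence h (1 - e) >= 0.  The reverse inequality comes from
   n h (1-h)^n <= 1. *)
Theorem aug_ARP_of_sigma_complete (b : T) :
  chi b = 0 -> aug_sigma_complete -> exists e, aug_ARP b e.
Proof.
  intros Hb Hsc.
  destruct (pos_scaled_sq b) as (r & Hr & Hnm & Hcancel).
  set (g := (scal r * b)%T) in *. set (h := (g * g)%T).
  assert (Hh : pos h) by apply pos_sq.
  assert (Hchi : chi h = 0) by (unfold h, g; rewrite !chi_mul, Hb; ring).
  assert (Hscal1 : forall x, nm x <= 1 -> pos (1 - x * x)%T).
  { intros x Hx. rewrite <- (scal_1 T). apply nm_ale.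
    pose proof (nm_mul T x x). pose proof (nm_ge0 T x). nra. }
  assert (Hh1 : pos (1 - h)%T) by (apply Hscal1; exact Hnm).
  set (v := apow (1 - h)%T).
  assert (Hv : forall n, pos (v n)) by (intros n; apply pos_apow; exact Hh1).
  assert (HvS : forall n, v (S n) = ((1 - h) * v n)%T) by reflexivity.
  assert (Hv1 : forall n, pos (1 - v n)%T).
  { intros n. eapply pos_ale; [exact (apow_bernoulli h n Hh Hh1)|]. fold v.
    unfold ale. replace (1 - v n - (1 - v n - scal (INR n) * (h * v n)))%T
      with (scal (INR n) * (h * v n))%T by ring.
    apply pos_scal_mul; [apply pos_INR | apply pos_mul; [exact Hh | apply Hv]]. }
  assert (Hchiv : forall n, chi (v n) = 1).
  { intros n. induction n as [|n IH]; [apply chi_1|].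
    rewrite HvS, chi_mul, chi_sub, chi_1, Hchi, IH. ring. }
  destruct (Hsc (fun n => 1 - v n)%T) as (e & Hce & Hub & Hleast).
  - intros n. rewrite chi_sub, chi_1, Hchiv. ring.
  - exists 1. intros n. apply ale_nm; [apply Hv1|].
    unfold ale. replace (1 - (1 - v n))%T with (v n) by ring. apply Hv.
  - intros n. unfold ale. rewrite HvS.
    replace (1 - (1 - h) * v n - (1 - v n))%T with (h * v n)%T by ring.
    apply pos_mul; [exact Hh | apply Hv].
  - assert (Hpe : pos e).
    { specialize (Hub 0%nat). unfold ale in Hub.
      replace e with (e - (1 - v 0%nat))%T by (change (v 0%nat) with (1%T : T); ring).
      exact Hub. }
    assert (Hann : forall s, (h * s = 0)%T -> (e * s = 0)%T).
    { intros s Hs. destruct (pos_scaled_sq s) as (c & _ & Hc1 & Hc2). apply Hc2.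
      set (k := (scal c * s)%T) in *.
      assert (Hhk : (h * k = 0)%T).
      { unfold k. replace (h * (scal c * s))%T with (scal c * (h * s))%T by ring.
        rewrite Hs. ring. }
      (* Since h k = 0, every factor 1 - h fixes [k]; hence e - e k^2 - u_n = (e - u_n)(1 - k^2), a
         product of positive elements. *)
      assert (Hvk : forall n, (v n * k = k)%T).
      { intros n. induction n as [|n IH]; [change (v 0%nat) with (1%T : T); ring|].
        rewrite HvS. replace ((1 - h) * v n * k)%T with (v n * k - v n * (h * k))%T by ring.
        rewrite IH, Hhk. ring. }
      assert (Hek : (e * (k * k) = 0)%T).
      { apply pos_antisym; [apply pos_mul; [exact Hpe | apply pos_sq]|].
        replace (- (e * (k * k)))%T with (e - e * (k * k) - e)%T by ring.
        apply Hleast.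
        - rewrite chi_sub, chi_mul, Hce. ring.
        - intros n. unfold ale.
          replace (e - e * (k * k) - (1 - v n))%T
            with ((e - (1 - v n)) * (1 - k * k) - k * k + v n * k * k)%T by ring.
          rewrite Hvk.
          replace ((e - (1 - v n)) * (1 - k * k) - k * k + k * k)%T
            with ((e - (1 - v n)) * (1 - k * k))%T by ring.
          apply pos_mul; [apply Hub | apply Hscal1; exact Hc1]. }
      apply sq_eq0. replace (e * k * (e * k))%T with (e * (e * (k * k)))%T by ring.
      rewrite Hek. ring. }
    set (f := (1 - e)%T).
    assert (Hle : forall n, pos (v n - f)%T).
    { intros n. unfold f. replace (v n - (1 - e))%T with (e - (1 - v n))%T by ring. apply Hub. }
    assert (Hneg : pos (- (h * f))%T).
    { apply pos_archimedean. intros eps Heps.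
      (* For n eps >= 1, n(eps - h f) splits into n h (v_n - f), the Bernoulli remainder, v_n and n
         eps - 1, all positive. *)
      destruct (INR_unbounded (/ eps)) as [n Hn].
      assert (H0 : 0 < / eps) by (apply Rinv_0_lt_compat; lra).
      assert (Hn1 : 1 <= eps * INR n).
      { rewrite <- (Rinv_r eps) by lra. apply Rmult_le_compat_l; lra. }
      apply (pos_unscal (INR n)); [lra|].
      replace (scal (INR n) * (- (h * f) + scal eps))%T
        with (scal (INR n) * (h * (v n - f))
              + (1 - v n - scal (INR n) * (h * v n) + v n
              + (scal (INR n) * scal eps - 1)))%T by ring.
      apply pos_add.
      - apply pos_scal_mul; [apply pos_INR | apply pos_mul; [exact Hh | apply Hle]].
      - apply pos_add; [apply pos_add; [apply apow_bernoulli; assumption | apply Hv]|].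
        rewrite <- scal_mul, <- (scal_1 T), <- scal_sub. apply pos_scal. lra. }
    assert (Hhf : (h * f = 0)%T).
    { apply pos_antisym; [|exact Hneg].
      replace (h * f)%T with (e + h * f - e)%T by ring. apply Hleast.
      - rewrite chi_add, chi_mul, Hchi, Hce. ring.
      - assert (HS : forall n, (1 - v (S n))%T <=t (e + h * f)%T).
        { intros n. unfold ale. rewrite HvS.
          replace (e + h * f - (1 - (1 - h) * v n))%T
            with ((1 - h) * (v n - f))%T by (unfold f; ring).
          apply pos_mul; [exact Hh1 | apply Hle]. }
        intros [|n]; [|apply HS]. apply (ale_trans _ (1 - v 1%nat)%T); [|apply HS].
        unfold ale. change (v 0%nat) with (1%T : T).
        replace (1 - v 1%nat - (1 - 1))%T with (1 - v 1%nat)%T by ring. apply Hv1. }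
    exists e. split; [exact Hce|]. split; [|split].
    + replace (e * e)%T with (e - e * f)%T by (unfold f; ring).
      rewrite (Hann f Hhf). ring.
    + assert (Hgf : (f * g = 0)%T).
      { apply sq_eq0. replace (f * g * (f * g))%T with (f * (h * f))%T by (unfold h; ring).
        rewrite Hhf. ring. }
      replace (b * e)%T with (b - f * b)%T by (unfold f; ring).
      rewrite (Hcancel f Hgf). ring.
    + intros y Hy. apply Hann. unfold h, g.
      replace (scal r * b * (scal r * b) * y)%T
        with (scal r * scal r * b * (b * y))%T by ring.
      rewrite Hy. ring.
Qed.

(* [pp_spec x y] says that [y] is the positive part of [x]; then [y - x] is the negative part. *)
Definition pp_spec x y : Prop := pos y /\ pos (y - x)%T /\ (y * (y - x) = 0)%T.

(** * Order properties of the positive part *)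

Lemma pp_exists x : exists y, pp_spec x y.
Proof.
  destruct (pos_part_exists x) as (y & z & Hy & Hz & -> & Hyz). exists y.
  unfold pp_spec. replace (y - (y - z))%T with z by ring. auto.
Qed.

Definition pp x : T := proj1_sig (constructive_indefinite_description _ (pp_exists x)).

Lemma ppP x : pp_spec x (pp x).
Proof. exact (proj2_sig (constructive_indefinite_description _ (pp_exists x))). Qed.

(** Let q be the negative part of w - y. Where q > 0, a positive y would equal x <= w, so q y = 0;
    then w q = - q^2, and w >= 0 forces q = 0. *)
Lemma pp_least x w : pos w -> x <=t w -> pp x <=t w.
Proof.
  intros Hw Hxw. destruct (ppP x) as (Hy & Hz & Hyz).
  set (y := pp x) in *. set (z := (y - x)%T) in *.
  destruct (pos_part_exists (w - y)%T) as (q' & q & Hq' & Hq & Hd & Hqq).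
  assert (H1 : ((w - y) * q = - (q * q))%T).
  { rewrite Hd. replace ((q' - q) * q)%T with (q' * q - q * q)%T by ring. rewrite Hqq. ring. }
  assert (Hyq : (q * y = 0)%T).
  { apply sq_eq0. replace (q * y * (q * y))%T with (q * q * y * y)%T by ring.
    replace (q * q * y)%T with (0%T : T); [ring|]. symmetry. apply pos_antisym.
    - repeat apply pos_mul; assumption.
    - replace (- (q * q * y))%T with ((w - x) * q * y)%T.
      + apply pos_mul; [apply pos_mul|]; assumption.
      + replace ((w - x) * q * y)%T with ((w - y) * q * y + q * (y * z))%T by (unfold z; ring).
        rewrite H1, Hyz. ring. }
  assert (Hq0 : q = 0%T).
  { apply sq_eq0, pos_antisym; [apply pos_sq|]. rewrite <- H1.
    replace ((w - y) * q)%T with (w * q - q * y)%T by ring. rewrite Hyq.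
    replace (w * q - 0)%T with (w * q)%T by ring. apply pos_mul; assumption. }
  unfold ale. rewrite Hd, Hq0. replace (q' - 0)%T with q' by ring. exact Hq'.
Qed.

Lemma pp_mono x y : x <=t y -> pp x <=t pp y.
Proof.
  intros H. destruct (ppP y) as (H1 & H2 & _). apply pp_least; [exact H1|].
  eapply ale_trans; [exact H | exact H2].
Qed.

(** Multiplying y - x >= 0 by a = x_+ and z = y_- gives - (a^2 z + z^2 a), a negative element, so
    both summands vanish. *)
Lemma pp_disjoint x y : x <=t y -> (pp x * (pp y - y) = 0)%T.
Proof.
  intros H. destruct (ppP x) as (Ha & _ & Ha0). destruct (ppP y) as (_ & Hz & Hz0).
  set (a := pp x) in *. set (b := pp y) in *. set (z := (b - y)%T) in *.
  assert (Hs : (a * a * z + z * z * a = 0)%T).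
  { apply pos_antisym.
    - apply pos_add; apply pos_mul; try apply pos_sq; assumption.
    - replace (- (a * a * z + z * z * a))%T with ((y - x) * a * z)%T.
      + apply pos_mul; [apply pos_mul|]; assumption.
      + replace ((y - x) * a * z)%T
          with (a * (a - x) * z + a * (b * z) - (a * a * z + z * z * a))%T by (unfold z; ring).
        rewrite Ha0, Hz0. ring. }
  assert (Haz : (a * a * z = 0)%T).
  { eapply pos_sum0; [| |exact Hs]; apply pos_mul; try apply pos_sq; assumption. }
  apply sq_eq0. replace (a * z * (a * z))%T with (a * a * z * z)%T by ring.
  rewrite Haz. ring.
Qed.

(** * Binary series of contractions *)

#[local] Arguments pow : simpl never.

(** Serves twice: to merge countably many positive contractions into one element whose range
    projection fixes them all, and to assemble a supremum from its digit projections. *)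
Fixpoint bsum (x : nat -> T) (n : nat) : T :=
  match n with O => 0%T | S m => (bsum x m + scal ((1 / 2) ^ S m) * x m)%T end.

Lemma half_pow_pos n : 0 < (1 / 2) ^ n.
Proof. apply pow_lt. lra. Qed.

Lemma half_pow_small eps : 0 < eps -> exists N, forall n, (N <= n)%nat -> (1 / 2) ^ n < eps.
Proof.
  intros H. destruct (pow_lt_1_zero (1 / 2)) with (y := eps) as [N HN].
  - rewrite Rabs_pos_eq; lra.
  - exact H.
  - exists N. intros n Hn. specialize (HN n Hn).
    rewrite Rabs_pos_eq in HN; [exact HN | left; apply half_pow_pos].
Qed.

Lemma bsum_dist (x : nat -> T) n k : (forall i, nm (x i) <= 1) ->
  nm (bsum x (n + k) - bsum x n)%T <= (1 / 2) ^ n - (1 / 2) ^ (n + k).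
Proof.
  intros Hx. induction k as [|k IH].
  - rewrite Nat.add_0_r. replace (bsum x n - bsum x n)%T with (0%T : T) by ring.
    rewrite nm_0. lra.
  - rewrite Nat.add_succ_r.
    pose proof (nm_dist (bsum x (S (n + k))) (bsum x (n + k)) (bsum x n)) as H1.
    replace (bsum x (S (n + k)) - bsum x (n + k))%T
      with (scal ((1 / 2) ^ S (n + k)) * x (n + k)%nat)%T in H1
      by (change (bsum x (S (n + k)))
            with (bsum x (n + k) + scal ((1 / 2) ^ S (n + k)) * x (n + k)%nat)%T; ring).
    pose proof (half_pow_pos (S (n + k))) as H2.
    pose proof (nm_scal_mul ((1 / 2) ^ S (n + k)) (x (n + k)%nat) ltac:(lra)) as H3.
    specialize (Hx (n + k)%nat).
    assert (H4 : (1 / 2) ^ S (n + k) * nm (x (n + k)%nat) <= (1 / 2) ^ S (n + k) * 1)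
      by (apply Rmult_le_compat_l; lra).
    assert (H5 : (1 / 2) ^ S (n + k) = 1 / 2 * (1 / 2) ^ (n + k)) by reflexivity.
    lra.
Qed.

Lemma bsum_limit (x : nat -> T) : (forall i, nm (x i) <= 1) ->
  exists s, forall n, nm (s - bsum x n)%T <= (1 / 2) ^ n.
Proof.
  intros Hx.
  assert (Hd : forall n m, (n <= m)%nat -> nm (bsum x m - bsum x n)%T <= (1 / 2) ^ n).
  { intros n m H. replace m with (n + (m - n))%nat by lia.
    pose proof (bsum_dist x n (m - n) Hx). pose proof (half_pow_pos (n + (m - n))). lra. }
  destruct (aug_complete T (bsum x)) as [s Hs].
  - intros eps Heps. destruct (half_pow_small eps Heps) as [N HN]. exists N.
    intros m n Hm Hn. destruct (Nat.le_ge_cases n m) as [H|H].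
    + eapply Rle_lt_trans; [apply Hd, H | apply HN, Hn].
    + rewrite nm_subC. eapply Rle_lt_trans; [apply Hd, H | apply HN, Hm].
  - exists s. intros n. apply Rle_plus_epsilon. intros eps Heps.
    destruct (Hs eps Heps) as [N HN].
    specialize (HN (max n N) ltac:(lia)). specialize (Hd n (max n N) ltac:(lia)).
    pose proof (nm_dist s (bsum x (max n N)) (bsum x n)) as H1.
    rewrite (nm_subC s (bsum x (max n N))) in H1. lra.
Qed.

Section BinarySeries.
Variables (x : nat -> T) (s : T).
Hypothesis Hs : forall n, nm (s - bsum x n)%T <= (1 / 2) ^ n.

Lemma bsum_chi : (forall n, chi (x n) = 0) -> chi s = 0.
Proof.
  intros Hx.
  assert (H0 : forall n, chi (bsum x n) = 0).
  { intros n. induction n as [|n IH]; [apply chi_0|].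
    simpl bsum. rewrite chi_add, chi_mul, IH, Hx. ring. }
  assert (H : forall n, Rabs (chi s) <= (1 / 2) ^ n).
  { intros n. replace (chi s) with (chi (s - bsum x n)%T) by (rewrite chi_sub, H0; ring).
    eapply Rle_trans; [apply chi_nm | apply Hs]. }
  destruct (Req_dec (chi s) 0) as [|Hne]; [assumption|].
  destruct (half_pow_small (Rabs (chi s)) (Rabs_pos_lt _ Hne)) as [N HN].
  specialize (HN N (le_n N)). specialize (H N). lra.
Qed.

Lemma bsum_pos_limit t (y : nat -> T) (c : R) :
  (forall n, pos (y n)) -> (forall n, nm (y n - t)%T <= c * (1 / 2) ^ n) -> pos t.
Proof.
  intros Hy Hd. apply pos_limit. intros eps Heps.
  assert (Hc : 0 < Rabs c + 1) by (pose proof (Rabs_pos c); lra).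
  destruct (half_pow_small (eps / (Rabs c + 1))) as [N HN].
  { apply Rdiv_lt_0_compat; assumption. }
  exists (y N). split; [apply Hy|]. specialize (HN N (le_n N)). specialize (Hd N).
  pose proof (half_pow_pos N). pose proof (Rle_abs c).
  assert ((Rabs c + 1) * (1 / 2) ^ N <= eps).
  { replace eps with ((Rabs c + 1) * (eps / (Rabs c + 1))) by (field; lra).
    apply Rmult_le_compat_l; lra. }
  nra.
Qed.

Lemma bsum_mono n k : (forall i, pos (x i)) -> pos (bsum x (n + k) - bsum x n)%T.
Proof.
  intros Hx. induction k as [|k IH].
  - rewrite Nat.add_0_r. apply ale_refl.
  - rewrite Nat.add_succ_r. simpl bsum.
    replace (bsum x (n + k) + scal ((1 / 2) ^ S (n + k)) * x (n + k)%nat - bsum x n)%T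
      with (bsum x (n + k) - bsum x n + scal ((1 / 2) ^ S (n + k)) * x (n + k)%nat)%T by ring.
    apply pos_add; [exact IH|]. apply pos_scal_mul; [|apply Hx]. left; apply half_pow_pos.
Qed.

Lemma bsum_le n : (forall i, pos (x i)) -> pos (s - bsum x n)%T.
Proof.
  intros Hx. apply (bsum_pos_limit _ (fun k => bsum x (n + k) - bsum x n)%T ((1 / 2) ^ n)).
  - intros k. apply bsum_mono, Hx.
  - intros k. rewrite nm_subC.
    replace (s - bsum x n - (bsum x (n + k) - bsum x n))%T with (s - bsum x (n + k))%T by ring.
    rewrite <- pow_add. apply Hs.
Qed.

Lemma bsum_term n : (forall i, pos (x i)) -> pos (s - scal ((1 / 2) ^ S n) * x n)%T.
Proof.
  intros Hx. replace (s - scal ((1 / 2) ^ S n) * x n)%T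
    with (s - bsum x (S n) + (bsum x (0 + n) - bsum x 0))%T by (simpl bsum; ring).
  apply pos_add; [apply bsum_le, Hx | apply bsum_mono, Hx].
Qed.

Lemma bsum_annihilates y : (forall n, (x n * y = 0)%T) -> (s * y = 0)%T.
Proof.
  intros Hx.
  assert (H0 : forall n, (bsum x n * y = 0)%T).
  { intros n. induction n as [|n IH]; simpl; [ring|].
    replace ((bsum x n + scal ((1 / 2) ^ S n) * x n) * y)%T
      with (bsum x n * y + scal ((1 / 2) ^ S n) * (x n * y))%T by ring.
    rewrite IH, Hx. ring. }
  apply nm_small. intros eps Heps. pose proof (nm_ge0 T y) as Hy.
  destruct (half_pow_small (eps / (nm y + 1))) as [N HN].
  { apply Rdiv_lt_0_compat; lra. }
  specialize (HN N (le_n N)). specialize (Hs N).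
  replace (s * y)%T with ((s - bsum x N) * y + bsum x N * y)%T by ring.
  rewrite H0. replace ((s - bsum x N) * y + 0)%T with ((s - bsum x N) * y)%T by ring.
  eapply Rle_trans; [apply nm_mul|].
  replace eps with (eps / (nm y + 1) * (nm y + 1)) by (field; lra).
  apply Rmult_le_compat; try apply nm_ge0; lra.
Qed.

End BinarySeries.

(** Both the tail of the series and the remainder after [n] digits have norm at most 2^(-n), whence
    the constant 2. *)
Lemma bsum_upper (x : nat -> T) s t (y : nat -> T) :
  (forall n, nm (s - bsum x n)%T <= (1 / 2) ^ n) ->
  (forall n, nm (y n) <= 1) ->
  (forall n, t <=t (bsum x n + scal ((1 / 2) ^ n) * y n)%T) -> t <=t s.
Proof.
  intros Hs Hy H.
  apply (bsum_pos_limit _ (fun n => bsum x n + scal ((1 / 2) ^ n) * y n - t)%T 2).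
  - intros n. apply H.
  - intros n. pose proof (half_pow_pos n) as Hp.
    replace (bsum x n + scal ((1 / 2) ^ n) * y n - t - (s - t))%T
      with (scal ((1 / 2) ^ n) * y n - (s - bsum x n))%T by ring.
    eapply Rle_trans; [apply nm_sub|].
    pose proof (nm_scal_mul ((1 / 2) ^ n) (y n) ltac:(lra)).
    assert ((1 / 2) ^ n * nm (y n) <= (1 / 2) ^ n * 1)
      by (apply Rmult_le_compat_l; [lra | apply Hy]).
    specialize (Hs n). lra.
Qed.

Lemma bsum_lower (x : nat -> T) s t :
  (forall n, nm (s - bsum x n)%T <= (1 / 2) ^ n) ->
  (forall n, bsum x n <=t t) -> s <=t t.
Proof.
  intros Hs H. apply (bsum_pos_limit _ (fun n => t - bsum x n)%T 1).
  - exact H.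
  - intros n. replace (t - bsum x n - (t - s))%T with (s - bsum x n)%T by ring.
    specialize (Hs n). lra.
Qed.

(** * Binary digits of a supremum *)

Lemma pos_idem e : (e * e = e)%T -> pos e.
Proof. intros H. exists e. symmetry. exact H. Qed.

Lemma idem_compl e : (e * e = e)%T -> ((1 - e) * (1 - e) = 1 - e)%T.
Proof.
  intros H. replace ((1 - e) * (1 - e))%T with (1 - e - e + e * e)%T by ring.
  rewrite H. ring.
Qed.

Definition unit_increasing (u : nat -> T) : Prop :=
  (forall n, chi (u n) = 0) /\ (forall n, pos (u n)) /\ (forall n, u n <=t 1%T) /\
  (forall n, u n <=t u (S n)).

(* The leading binary digit of the supremum of [u] is the projection [p];
   [u'] is the sequence whose supremum carries the remaining digits. *)
Definition digit_step (u : nat -> T) p (u' : nat -> T) : Prop :=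
  chi p = 0 /\ (p * p = p)%T /\ unit_increasing u' /\
  (forall n, u n <=t (scal (1 / 2) * (p + u' n))%T) /\
  (forall t, (forall n, u n <=t t) -> forall n, u' n <=t (t + t - p)%T).

Hypothesis HARP : forall x, chi x = 0 -> exists e, aug_ARP x e.

(** On the support of [p] some u_n exceeds 1/2: the digit is 1 and the remainder is 2(u_n - 1/2)_+.
    Off the support all u_n are at most 1/2: the digit is 0 and the remainder is 2 u_n. Both cases
    are contained in 2 d_n. The early u_n may lie below 1/2 on the support; truncation at 0 keeps
    the remainder positive, so u_n <= (p + u'_n)/2 is only an inequality. *)
Lemma digit_step_exists (u : nat -> T) : unit_increasing u -> exists p, exists u' : nat -> T, digit_step u p u'.
Proof.
  intros (Hchi & Hpos & Hle1 & Hinc).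
  set (c := scal (1 / 2) : T).
  assert (Hcc : (c + c = 1)%T).
  { unfold c. rewrite <- scal_add, <- scal_1. f_equal. field. }
  assert (Hc : pos c) by (apply pos_scal; lra).
  assert (Hc1 : c <=t 1%T).
  { unfold ale. rewrite <- Hcc. replace (c + c - c)%T with c by ring. exact Hc. }
  set (w := fun n => pp (u n - c)%T).
  assert (Hw : forall n, pos (w n)) by (intros n; apply ppP).
  assert (Hwu : forall n, pos (w n - (u n - c))%T) by (intros n; apply ppP).
  assert (Hwc : forall n, w n <=t c).
  { intros n. apply pp_least; [exact Hc|]. unfold ale.
    replace (c - (u n - c))%T with (c + c - u n)%T by ring. rewrite Hcc. apply Hle1. }
  (* Applying [chi] to w(w - (u - 1/2)) = 0 gives chi w (chi w + 1/2) = 0 with chi w >= 0: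
     truncating above 1/2 stays inside the original algebra. *)
  assert (Hchiw : forall n, chi (w n) = 0).
  { intros n. destruct (ppP (u n - c)%T) as (H1 & _ & H2). fold (w n) in H1, H2.
    apply chi_pos in H1. apply (f_equal chi) in H2.
    rewrite chi_mul, !chi_sub, Hchi, chi_0 in H2. unfold c in H2.
    rewrite chi_scal in H2. nra. }
  assert (Hwn : forall n, nm (w n) <= 1).
  { intros n. apply ale_nm; [apply Hw|]. eapply ale_trans; [apply Hwc | exact Hc1]. }
  assert (Hwinc : forall n, w n <=t w (S n)).
  { intros n. apply pp_mono. specialize (Hinc n). unfold ale in *.
    replace (u (S n) - c - (u n - c))%T with (u (S n) - u n)%T by ring. exact Hinc. }
  destruct (bsum_limit w Hwn) as [W HW].
  destruct (HARP W (bsum_chi w W HW Hchiw)) as (p & Hchip & Hpp & HWp & Hann).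
  pose proof (pos_idem p Hpp) as Hp. pose proof (pos_idem _ (idem_compl p Hpp)) as Hp1.
  (* A positive multiple of w_n lies below [W], and compressing by 1 - p sends [W] to 0. *)
  assert (Hwp : forall n, (p * w n = w n)%T).
  { intros n.
    assert (H0 : (scal ((1 / 2) ^ S n) * (w n * (1 - p)) = 0)%T).
    { pose proof (half_pow_pos (S n)).
      apply (pos_diff0 _ (W * (1 - p))%T).
      - apply pos_scal_mul; [lra | apply pos_mul; [apply Hw | exact Hp1]].
      - unfold ale.
        replace (W * (1 - p) - scal ((1 / 2) ^ S n) * (w n * (1 - p)))%T
          with ((W - scal ((1 / 2) ^ S n) * w n) * (1 - p))%T by ring.
        apply pos_mul; [apply bsum_term; assumption | exact Hp1].
      - replace (W * (1 - p))%T with (W - W * p)%T by ring. rewrite HWp. ring. }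
    replace (p * w n)%T with (w n - w n * (1 - p))%T by ring.
    rewrite <- (scal_K (/ (1 / 2) ^ S n) (w n * (1 - p))%T).
    - rewrite Rinv_inv, H0. ring.
    - pose proof (half_pow_pos (S n)). apply Rinv_neq_0_compat. lra. }
  set (d := fun n => (u n * (1 - p) + w n)%T).
  assert (Hd : forall n, (scal (1 / 2) * (p + (d n + d n)) = c * p + d n)%T).
  { intros n. fold c. replace (c * (p + (d n + d n)))%T with (c * p + (c + c) * d n)%T by ring.
    rewrite Hcc. ring. }
  exists p, (fun n => d n + d n)%T.
  split; [exact Hchip|]. split; [exact Hpp|].
  assert (Hchid : forall n, chi (d n) = 0).
  { intros n. unfold d. rewrite chi_add, chi_mul, Hchi, Hchiw. ring. }
  assert (Hdpos : forall n, pos (d n)).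
  { intros n. apply pos_add; [apply pos_mul; [apply Hpos | exact Hp1] | apply Hw]. }
  (* On [p] the difference is c - w_n, off [p] it is w_n - (u_n - c); the added terms p w_n - w_n
     vanish. *)
  assert (Hdc : forall n, pos (c - d n)%T).
  { intros n.
    replace (c - d n)%T
      with (p * (c - w n) + (1 - p) * (w n - (u n - c)) + (p * w n - w n) + (p * w n - w n))%T
      by (unfold d; ring).
    rewrite Hwp.
    replace (p * (c - w n) + (1 - p) * (w n - (u n - c)) + (w n - w n) + (w n - w n))%T
      with (p * (c - w n) + (1 - p) * (w n - (u n - c)))%T by ring.
    apply pos_add; apply pos_mul; try assumption; [apply Hwc | apply Hwu]. }
  assert (Hdinc : forall n, pos (d (S n) - d n)%T).
  { intros n.
    replace (d (S n) - d n)%T with ((u (S n) - u n) * (1 - p) + (w (S n) - w n))%T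
      by (unfold d; ring).
    apply pos_add; [apply pos_mul; [apply Hinc | exact Hp1] | apply Hwinc]. }
  split; [|split].
  - split; [|split; [|split]]; intros n.
    + rewrite chi_add, Hchid. ring.
    + apply pos_add; apply Hdpos.
    + unfold ale. rewrite <- Hcc.
      replace (c + c - (d n + d n))%T with (c - d n + (c - d n))%T by ring.
      apply pos_add; apply Hdc.
    + unfold ale.
      replace (d (S n) + d (S n) - (d n + d n))%T
        with (d (S n) - d n + (d (S n) - d n))%T by ring.
      apply pos_add; apply Hdinc.
  - intros n. rewrite Hd. unfold ale.
    replace (c * p + d n - u n)%T
      with (p * (w n - (u n - c)) + (w n - p * w n))%T by (unfold d; ring).
    rewrite Hwp.
    replace (p * (w n - (u n - c)) + (w n - w n))%T with (p * (w n - (u n - c)))%T by ring.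
    apply pos_mul; [exact Hp | apply Hwu].
  - intros t Ht n.
    assert (Hmono : forall k, (u k - c)%T <=t (t - c)%T).
    { intros k. specialize (Ht k). unfold ale in *.
      replace (t - c - (u k - c))%T with (t - u k)%T by ring. exact Ht. }
    (* Every upper bound is at least 1/2 on the support of [p]: the negative part of t - 1/2 is
       orthogonal to each w_k, hence to [W] and to [p]. *)
    assert (Hpz : (p * (pp (t - c) - (t - c)) = 0)%T).
    { apply Hann, (bsum_annihilates w W HW). intros k. apply pp_disjoint, Hmono. }
    unfold ale.
    replace (t + t - p - (d n + d n))%T
      with (t + t - (c + c) * p - (d n + d n))%T by (rewrite Hcc; ring).
    set (z := (pp (t - c) - (t - c))%T) in *.
    replace (t + t - (c + c) * p - (d n + d n))%T
      with (t - c * p - d n + (t - c * p - d n))%T by ring.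
    assert (H : pos (t - c * p - d n)%T).
    { replace (t - c * p - d n)%T
        with ((1 - p) * (t - u n) + p * (pp (t - c) - w n) + (p * w n - w n) - p * z)%T
        by (unfold z, d; ring).
      rewrite Hpz, Hwp.
      replace ((1 - p) * (t - u n) + p * (pp (t - c) - w n) + (w n - w n) - 0)%T
        with ((1 - p) * (t - u n) + p * (pp (t - c) - w n))%T by ring.
      apply pos_add; apply pos_mul; try assumption; [apply Ht | apply pp_mono, Hmono]. }
    apply pos_add; exact H.
Qed.

(** The subtype carries the invariant, so a chosen digit step can be iterated. *)
Lemma digits_exist (u : nat -> T) : unit_increasing u ->
  exists U : nat -> nat -> T, exists P : nat -> T,
    U 0%nat = u /\ forall k, unit_increasing (U k) /\ digit_step (U k) (P k) (U (S k)).
Proof.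
  intros Hu.
  assert (Hstep : forall v : {v | unit_increasing v},
    {pv : T * (nat -> T) | digit_step (proj1_sig v) (fst pv) (snd pv)}).
  { intros [v Hv]. apply constructive_indefinite_description.
    destruct (digit_step_exists v Hv) as (p & v' & H). exists (p, v'). exact H. }
  set (next := fun v : {v | unit_increasing v} => exist unit_increasing (snd (proj1_sig (Hstep v)))
    (proj1 (proj2 (proj2 (proj2_sig (Hstep v)))))).
  set (st := fun k => Nat.iter k next (exist unit_increasing u Hu)).
  exists (fun k => proj1_sig (st k)), (fun k => fst (proj1_sig (Hstep (st k)))).
  split; [reflexivity|]. intros k. split; [apply (proj2_sig (st k))|].
  exact (proj2_sig (Hstep (st k))).
Qed.

Lemma unit_increasing_sup (u : nat -> T) : unit_increasing u ->
  exists s, chi s = 0 /\ (forall n, u n <=t s) /\ (forall t, (forall n, u n <=t t) -> s <=t t).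
Proof.
  intros Hu. destruct (digits_exist u Hu) as (U & P & HU0 & HU).
  assert (HP : forall k, nm (P k) <= 1).
  { intros k. destruct (HU k) as (_ & _ & Hp & _).
    apply ale_nm; [apply pos_idem, Hp | apply (pos_idem _ (idem_compl _ Hp))]. }
  destruct (bsum_limit P HP) as [s Hs].
  exists s. split; [|split].
  - apply (bsum_chi P s Hs). intros k. apply HU.
  - intros n. apply (bsum_upper P s (u n) (fun m => U m n) Hs).
    + intros m. destruct (HU m) as ((_ & H1 & H2 & _) & _). apply ale_nm; [apply H1 | apply H2].
    (* Iterating the upper estimate of a digit step bounds u_n by the first m digits plus 2^(-m)
       U_m(n). *)
    + intros m. induction m as [|m IH].
      * rewrite HU0. simpl bsum. rewrite pow_O, scal_1.
        replace (0 + 1 * u n)%T with (u n) by ring. apply ale_refl.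
      * eapply ale_trans; [exact IH|].
        destruct (HU m) as (_ & _ & _ & _ & Hub & _). specialize (Hub n). unfold ale in *.
        simpl bsum.
        replace ((1 / 2) ^ S m) with ((1 / 2) ^ m * (1 / 2)) by (rewrite <- tech_pow_Rmult; ring).
        rewrite scal_mul.
        replace (bsum P m + scal ((1 / 2) ^ m) * scal (1 / 2) * P m
            + scal ((1 / 2) ^ m) * scal (1 / 2) * U (S m) n
            - (bsum P m + scal ((1 / 2) ^ m) * U m n))%T
          with (scal ((1 / 2) ^ m) * (scal (1 / 2) * (P m + U (S m) n) - U m n))%T by ring.
        apply pos_scal_mul; [left; apply half_pow_pos | exact Hub].
  - intros t Ht. apply (bsum_lower P s t Hs).
    (* Subtracting digits from the bound [t] leaves 2^(-m) r with r above every term of U_m; so r is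
       positive and the partial sums stay below [t]. *)
    assert (H : forall m, exists r, (forall n, U m n <=t r) /\
      t = (bsum P m + scal ((1 / 2) ^ m) * r)%T).
    { intros m. induction m as [|m (r & Hr & Htr)].
      - exists t. split; [rewrite HU0; exact Ht|]. simpl bsum. rewrite pow_O, scal_1. ring.
      - destruct (HU m) as (_ & _ & _ & _ & _ & Hl). exists (r + r - P m)%T.
        split; [apply Hl, Hr|]. rewrite Htr. simpl bsum.
        replace ((1 / 2) ^ S m) with ((1 / 2) ^ m * (1 / 2)) by (rewrite <- tech_pow_Rmult; ring).
        rewrite scal_mul. rewrite <- (scal_half2 r) at 1. ring. }
    intros m. destruct (H m) as (r & Hr & ->). unfold ale.
    replace (bsum P m + scal ((1 / 2) ^ m) * r - bsum P m)%T
      with (scal ((1 / 2) ^ m) * r)%T by ring.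
    apply pos_scal_mul; [left; apply half_pow_pos|].
    destruct (HU m) as ((_ & H1 & _) & _). eapply pos_ale; [apply (H1 0%nat) | apply Hr].
Qed.

Theorem aug_sigma_complete_of_ARP : aug_sigma_complete.
Proof.
  (* The differences u_n - u_0 have norm at most 2K; adding 1 makes the scale strictly positive. *)
  intros u Hchi [K HK] Hinc. set (c := 2 * K + 1).
  assert (Hc : 0 < c).
  { pose proof (nm_ge0 T (u 0%nat)). specialize (HK 0%nat). unfold c. lra. }
  pose proof (Rinv_0_lt_compat c Hc) as Hci.
  set (v := fun n => (scal (/ c) * (u n - u 0%nat))%T).
  assert (Huv : forall n, u n = (u 0%nat + scal c * v n)%T).
  { intros n. unfold v. rewrite scal_K by lra. ring. }
  assert (Hinc0 : forall n, pos (u n - u 0%nat)%T).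
  { intros n. induction n as [|n IH]; [apply ale_refl|].
    eapply ale_trans; [exact IH | apply Hinc]. }
  destruct (unit_increasing_sup v) as (s & Hs & Hub & Hl).
  - split; [|split; [|split]]; intros n; unfold v.
    + rewrite chi_mul, chi_sub, !Hchi. ring.
    + apply pos_scal_mul; [lra | apply Hinc0].
    + rewrite <- (scal_1 T). apply nm_ale, nm_rescale; [|exact Hc].
      pose proof (nm_sub (u n) (u 0%nat)).
      pose proof (HK n). pose proof (HK 0%nat). unfold c. lra.
    + unfold ale.
      replace (scal (/ c) * (u (S n) - u 0%nat) - scal (/ c) * (u n - u 0%nat))%T
        with (scal (/ c) * (u (S n) - u n))%T by ring.
      apply pos_scal_mul; [lra | apply Hinc].
  - exists (u 0%nat + scal c * s)%T. split; [|split].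
    + rewrite chi_add, chi_mul, Hchi, Hs. ring.
    + intros n. rewrite (Huv n). unfold ale.
      replace (u 0%nat + scal c * s - (u 0%nat + scal c * v n))%T
        with (scal c * (s - v n))%T by ring.
      apply pos_scal_mul; [lra | apply Hub].
    + intros t _ Ht.
      assert (H : s <=t (scal (/ c) * (t - u 0%nat))%T).
      { apply Hl. intros n. unfold ale, v.
        replace (scal (/ c) * (t - u 0%nat) - scal (/ c) * (u n - u 0%nat))%T
          with (scal (/ c) * (t - u n))%T by ring.
        apply pos_scal_mul; [lra | apply Ht]. }
      unfold ale.
      replace (t - (u 0%nat + scal c * s))%T with (t - u 0%nat - scal c * s)%T by ring.
      rewrite <- (scal_K c (t - u 0%nat)%T) by lra.
      replace (scal c * (scal (/ c) * (t - u 0%nat)) - scal c * s)%T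
        with (scal c * (scal (/ c) * (t - u 0%nat) - s))%T by ring.
      apply pos_scal_mul; [lra | exact H].
Qed.

End Positivity.

(** * Commutants and maximal abelian subalgebras *)

(** Zorn is applied to the sets whose union with [S0] is a clique, instead of the cliques containing
    [S0]: the empty union of the empty chain then qualifies. *)
Lemma maximal_clique (X : Type) (rel : X -> X -> Prop) (S0 : X -> Prop) :
  (forall x y, S0 x -> S0 y -> rel x y) ->
  exists S : X -> Prop, (forall x, S0 x -> S x) /\ (forall x y, S x -> S y -> rel x y) /\
    (forall x, rel x x -> (forall y, S y -> rel x y /\ rel y x) -> S x).
Proof.
  intros H0.
  destruct (@classical_sets.Zorn_bigcup X
    (fun S => forall x y, S x \/ S0 x -> S y \/ S0 y -> rel x y)) as (S & HS & Hmax).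
  - intros F HF Htot x y [[B HB Hx]|Hx] [[C HC Hy]|Hy].
    + destruct (Htot B C HB HC) as [H|H].
      * apply (HF C HC); left; [apply H|]; assumption.
      * apply (HF B HB); left; [|apply H]; assumption.
    + apply (HF B HB); auto.
    + apply (HF C HC); auto.
    + apply H0; assumption.
  - exists (fun x => S x \/ S0 x). split; [auto|]. split; [exact HS|].
    intros x Hxx Hx. left. apply NNPP. intros Hn.
    apply (Hmax (fun y => S y \/ y = x)).
    + split; [intros y Hy; left; exact Hy|]. intros Hsub. apply Hn, Hsub. right. reflexivity.
    + intros y z [[Hy| ->]|Hy] [[Hz| ->]|Hz];
        try exact Hxx; try (apply HS; tauto); apply Hx; tauto.
Qed.

Section CStar.
Variable A : CStarAlgebra.

Declare Scope A_scope.
Delimit Scope A_scope with A.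
Local Notation "0" := (@cz A) : A_scope.
Local Notation "x + y" := (@cadd A x y) : A_scope.
Local Notation "x * y" := (@cmul A x y) : A_scope.
Local Notation "- x" := (@copp A x) : A_scope.
Local Notation "x - y" := (@cadd A x (@copp A y)) : A_scope.
Local Notation "x ^*" := (@cstar A x) (at level 2, format "x ^*") : A_scope.

Implicit Types x y z b c d e h k : A.

(** * Real scalars, involution and norm in the C*-algebra *)

Definition rs (r : R) x : A := csmul (mkC r 0) x.

Lemma Cplx_eq (a b : Cplx) : re a = re b -> im a = im b -> a = b.
Proof. destruct a, b. simpl. intros -> ->. reflexivity. Qed.

Lemma cadd_0l x : (0 + x = x)%A.
Proof. rewrite cadd_comm. apply cadd_0. Qed.

Lemma cadd_cancel x y z : (x + z = y + z)%A -> x = y.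
Proof.
  intros H. rewrite <- (cadd_0 A x), <- (cadd_0 A y), <- (cadd_opp A z), !cadd_assoc, H.
  reflexivity.
Qed.

Lemma cadd_swap x y z : (x + (y + z) = y + (x + z))%A.
Proof. rewrite !cadd_assoc, (cadd_comm A x y). reflexivity. Qed.

Lemma rs_add r s x : rs (r + s) x = (rs r x + rs s x)%A.
Proof. unfold rs. rewrite <- csmul_addl. f_equal. apply Cplx_eq; simpl; ring. Qed.

Lemma rs_addr r x y : rs r (x + y)%A = (rs r x + rs r y)%A.
Proof. apply csmul_addr. Qed.

Lemma rs_rs r s x : rs r (rs s x) = rs (r * s) x.
Proof. unfold rs. rewrite csmul_assoc. f_equal. apply Cplx_eq; simpl; ring. Qed.

Lemma rs_1 x : rs 1 x = x.
Proof. apply csmul_1. Qed.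

Lemma rs_0 x : rs 0 x = 0%A.
Proof.
  apply (cadd_cancel _ _ (rs 0 x)). rewrite <- rs_add, Rplus_0_r, cadd_0l. reflexivity.
Qed.

Lemma rs_mull r x y : (rs r x * y = rs r (x * y))%A.
Proof. apply cmul_smull. Qed.

Lemma rs_mulr r x y : (x * rs r y = rs r (x * y))%A.
Proof. apply cmul_smulr. Qed.

Lemma copp_rs x : (- x)%A = rs (-1) x.
Proof.
  apply (cadd_cancel _ _ x). rewrite (cadd_comm A (- x)%A), cadd_opp.
  rewrite <- (rs_1 x) at 2. rewrite <- rs_add. replace (-1 + 1) with 0 by ring.
  symmetry. apply rs_0.
Qed.

Lemma rs_zero r : rs r 0%A = 0%A.
Proof. rewrite <- (rs_0 0%A), rs_rs, Rmult_0_r. reflexivity. Qed.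

Lemma cmul_0l x : (0 * x = 0)%A.
Proof. rewrite <- (rs_0 0%A), rs_mull, rs_0. symmetry. apply rs_0. Qed.

Lemma cmul_0r x : (x * 0 = 0)%A.
Proof. rewrite <- (rs_0 0%A), rs_mulr, rs_0. symmetry. apply rs_0. Qed.

Lemma cstar_rs r x : ((rs r x)^* = rs r x^*)%A.
Proof. unfold rs. rewrite cstar_smul. f_equal. apply Cplx_eq; simpl; ring. Qed.

Lemma cstar_0 : ((0)^* = 0)%A.
Proof. rewrite <- (rs_0 0%A), cstar_rs, !rs_0. reflexivity. Qed.

Lemma csub_eq0 x y : (x - y = 0)%A -> x = y.
Proof. intros H. apply (cadd_cancel _ _ (- y)%A). rewrite H, cadd_opp. reflexivity. Qed.

(** Identities in the noncommutative algebra are proved by expanding both sides to right-nested sums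
    of scaled monomials, which [permute] aligns one summand at a time. *)
Ltac expand := repeat rewrite copp_rs; repeat first
  [ rewrite cstar_add | rewrite cstar_rs | rewrite cstar_mul | rewrite cstar_invol
  | rewrite cmul_addl | rewrite cmul_addr | rewrite rs_addr | rewrite rs_rs
  | rewrite rs_mull | rewrite rs_mulr | rewrite cmul_assoc ];
  repeat rewrite <- cadd_assoc.

(* [front a s] proves that the right-nested sum [s], which contains [a], equals [a + s']. *)
Ltac front a s :=
  lazymatch s with
  | (a + ?y)%A => constr:(@eq_refl _ s)
  | (?x + a)%A => constr:(cadd_comm A x a)
  | (?x + ?y)%A =>
      let p := front a y in
      lazymatch type of p with
      | _ = (a + ?y')%A => constr:(eq_trans (f_equal (@cadd A x) p) (cadd_swap x a y'))
      end
  end.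

Ltac permute := repeat
  lazymatch goal with
  | |- ?a = ?a => reflexivity
  | |- (?a + _ = ?s)%A => let p := front a s in refine (eq_trans _ (eq_sym p)); apply (f_equal (@cadd A a))
  end.

Lemma cnorm_rs r x : cnorm (rs r x) = Rabs r * cnorm x.
Proof.
  unfold rs. rewrite cnorm_smul. f_equal. unfold Cmod. simpl.
  rewrite Rmult_0_r, Rplus_0_r. apply sqrt_Rsqr_abs.
Qed.

Lemma cnorm_0 : cnorm (0%A) = 0.
Proof. rewrite <- (rs_0 0%A), cnorm_rs, Rabs_R0. ring. Qed.

Lemma cnorm_opp x : cnorm (- x)%A = cnorm x.
Proof. rewrite copp_rs, cnorm_rs, Rabs_left by lra. ring. Qed.

Lemma cnorm_star_le x : cnorm x <= cnorm (x^*)%A.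
Proof.
  destruct (Req_dec (cnorm x) 0) as [H|H].
  - rewrite H. apply cnorm_nonneg.
  - pose proof (cnorm_nonneg A x). apply Rmult_le_reg_r with (cnorm x); [lra|].
    rewrite <- cnorm_cstar. apply cnorm_submult.
Qed.

Lemma cnorm_star x : cnorm (x^*)%A = cnorm x.
Proof.
  apply Rle_antisym; [|apply cnorm_star_le].
  rewrite <- (cstar_invol A x) at 2. apply cnorm_star_le.
Qed.

Lemma cnorm_small x : (forall eps, 0 < eps -> cnorm x <= eps) -> x = 0%A.
Proof.
  intros H. apply cnorm_eq0. pose proof (cnorm_nonneg A x).
  destruct (Rle_lt_dec (cnorm x) 0); [lra|].
  specialize (H (cnorm x / 2) ltac:(lra)). lra.
Qed.

Lemma cstar_sq_eq0 x : (x^* * x = 0)%A -> x = 0%A.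
Proof.
  intros H. apply cnorm_eq0. pose proof (cnorm_cstar A x) as H1. rewrite H, cnorm_0 in H1.
  pose proof (cnorm_nonneg A x). nra.
Qed.

Lemma cnorm_sa_sq x : (x^* = x)%A -> cnorm (x * x)%A = cnorm x * cnorm x.
Proof. intros H. rewrite <- cnorm_cstar, H. reflexivity. Qed.

(** * Cartesian decomposition and the norm of a sum of two squares *)

Definition Ci := mkC 0 1.

(* The Cartesian decomposition z = h + i k. *)
Definition hpart x : A := rs (1 / 2) (x + x^*)%A.
Definition kpart x : A := csmul (mkC 0 (-1 / 2)) (x - x^*)%A.

Lemma hpart_sa x : ((hpart x)^* = hpart x)%A.
Proof. unfold hpart. rewrite cstar_rs, cstar_add, cstar_invol. f_equal. apply cadd_comm. Qed.

Lemma kpart_sa x : ((kpart x)^* = kpart x)%A.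
Proof.
  unfold kpart. rewrite cstar_smul, copp_rs, cstar_add, cstar_rs, cstar_invol.
  replace (Cconj (mkC 0 (-1 / 2))) with (Cmul (mkC 0 (-1 / 2)) (mkC (-1) 0))
    by (apply Cplx_eq; simpl; field).
  rewrite <- csmul_assoc. f_equal. fold (rs (-1) (x^* + rs (-1) x)%A).
  rewrite rs_addr, rs_rs. replace (-1 * -1) with 1 by ring. rewrite rs_1. apply cadd_comm.
Qed.

Lemma hk_decomp x : x = (hpart x + csmul Ci (kpart x))%A.
Proof.
  unfold kpart. rewrite csmul_assoc.
  replace (Cmul Ci (mkC 0 (-1 / 2))) with (mkC (1 / 2) 0)
    by (apply Cplx_eq; simpl; field).
  fold (rs (1 / 2) (x - x^*)%A). unfold hpart. rewrite <- rs_addr, copp_rs.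
  rewrite <- cadd_assoc, (cadd_swap (x^*)%A).
  rewrite <- (rs_1 (x^*)%A) at 1. rewrite <- rs_add. replace (1 + -1) with 0 by ring.
  rewrite rs_0, cadd_0, rs_addr, <- rs_add.
  replace (1 / 2 + 1 / 2) with 1 by field. symmetry. apply rs_1.
Qed.

Lemma hk_cstar h k : (h^* = h)%A -> (k^* = k)%A ->
  ((h + csmul Ci k)^* = h + csmul (mkC 0 (-1)) k)%A.
Proof.
  intros Hh Hk. rewrite cstar_add, cstar_smul, Hh, Hk.
  replace (Cconj Ci) with (mkC 0 (-1)) by (apply Cplx_eq; simpl; ring). reflexivity.
Qed.

Lemma hk_sq h k : (h^* = h)%A -> (k^* = k)%A -> (h * k = k * h)%A ->
  ((h + csmul Ci k)^* * (h + csmul Ci k) = h * h + k * k)%A.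
Proof.
  intros Hh Hk Hc. rewrite hk_cstar by assumption.
  rewrite !cmul_addl, !cmul_addr, !cmul_smull, !cmul_smulr, csmul_assoc, Hc.
  replace (Cmul (mkC 0 (-1)) Ci) with Defs.C1 by (apply Cplx_eq; simpl; ring). rewrite csmul_1.
  rewrite <- !cadd_assoc. f_equal. rewrite cadd_assoc, <- csmul_addl.
  replace (Cadd Ci (mkC 0 (-1))) with (mkC 0 0) by (apply Cplx_eq; simpl; ring).
  fold (rs 0 (k * h)%A). rewrite rs_0. apply cadd_0l.
Qed.

(** For commuting h, k and z = h + i k, h^2 + k^2 = z* z has norm |z|^2, and |h| <= |z| because h is
    the real part of z. This is the origin of [nm_sq]. *)
Lemma cnorm_sq_le h k : (h^* = h)%A -> (k^* = k)%A -> (h * k = k * h)%A ->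
  cnorm h * cnorm h <= cnorm (h * h + k * k)%A.
Proof.
  intros Hh Hk Hc. rewrite <- hk_sq, cnorm_cstar by assumption.
  set (z := (h + csmul Ci k)%A).
  assert (H : cnorm h <= cnorm z).
  { assert (Hz : h = rs (1 / 2) (z + z^*)%A).
    { unfold z. rewrite hk_cstar by assumption.
      rewrite <- cadd_assoc, (cadd_swap (csmul Ci k)), <- csmul_addl.
      replace (Cadd Ci (mkC 0 (-1))) with (mkC 0 0) by (apply Cplx_eq; simpl; ring).
      fold (rs 0 k). rewrite rs_0, cadd_0, rs_addr, <- rs_add.
      replace (1 / 2 + 1 / 2) with 1 by field. symmetry. apply rs_1. }
    rewrite Hz, cnorm_rs, Rabs_pos_eq by lra.
    pose proof (cnorm_triangle A z (z^*)%A) as H1. rewrite cnorm_star in H1. lra. }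
  pose proof (cnorm_nonneg A h). apply Rmult_le_compat; assumption.
Qed.

Lemma cdist_triangle x y z : cnorm (x - z)%A <= cnorm (x - y)%A + cnorm (y - z)%A.
Proof.
  replace (x - z)%A with (x - y + (y - z))%A; [apply cnorm_triangle|].
  rewrite <- cadd_assoc. f_equal. rewrite cadd_assoc, (cadd_comm A (- y)%A), cadd_opp.
  apply cadd_0l.
Qed.

Lemma cdistC x y : cnorm (x - y)%A = cnorm (y - x)%A.
Proof.
  rewrite <- cnorm_opp. f_equal. expand. replace (-1 * -1) with 1 by ring.
  rewrite rs_1. apply cadd_comm.
Qed.

Lemma csub_mull x y z : ((x - y) * z = x * z - y * z)%A.
Proof. rewrite cmul_addl, !copp_rs, rs_mull. reflexivity. Qed.

Lemma csub_mulr x y z : (z * (x - y) = z * x - z * y)%A.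
Proof. rewrite cmul_addr, !copp_rs, rs_mulr. reflexivity. Qed.

Lemma star_subalgebra_opp (M : A -> Prop) x : star_subalgebra A M -> M x -> M (- x)%A.
Proof. intros (_ & _ & H & _) Hx. rewrite copp_rs. apply H, Hx. Qed.

Lemma hpart_in (M : A -> Prop) x : star_subalgebra A M -> M x -> M (hpart x).
Proof. intros (_ & Ha & Hs & _ & Hst) Hx. apply Hs, Ha; [|apply Hst]; exact Hx. Qed.

Lemma kpart_in (M : A -> Prop) x : star_subalgebra A M -> M x -> M (kpart x).
Proof.
  intros HM Hx. pose proof HM as (_ & Ha & Hs & _ & Hst).
  apply Hs, Ha; [exact Hx|]. apply star_subalgebra_opp; [exact HM | apply Hst, Hx].
Qed.

(** * Commutants and membership in a masa *)

Definition commutant (S : A -> Prop) x : Prop := forall s, S s -> (x * s = s * x)%A.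

Lemma commutant_star_subalgebra (S : A -> Prop) :
  (forall s, S s -> S (s^*)%A) -> star_subalgebra A (commutant S).
Proof.
  intros HS. split; [|split; [|split; [|split]]].
  - intros s _. rewrite cmul_0l, cmul_0r. reflexivity.
  - intros x y Hx Hy s Hs. rewrite cmul_addl, cmul_addr, Hx, Hy by exact Hs. reflexivity.
  - intros a x Hx s Hs. rewrite cmul_smull, cmul_smulr, Hx by exact Hs. reflexivity.
  - intros x y Hx Hy s Hs. rewrite <- cmul_assoc, Hy, cmul_assoc, Hx, cmul_assoc by exact Hs.
    reflexivity.
  - intros x Hx s Hs. rewrite <- (cstar_invol A s), <- !cstar_mul. f_equal. symmetry.
    apply Hx, HS, Hs.
Qed.

(* M together with a self-adjoint x commuting with M generates the abelian
   *-algebra (M u {x})'', so maximality puts x in M. *)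
Lemma masa_mem (M : A -> Prop) x :
  is_masa A M -> (x^* = x)%A -> (forall m, M m -> (x * m = m * x)%A) -> M x.
Proof.
  intros (HM & Hab & Hmax) Hx Hc.
  set (S := fun y => M y \/ y = x).
  assert (HS : forall s, S s -> S (s^*)%A).
  { intros s [Hs| ->]; [left; apply HM, Hs | right; exact Hx]. }
  assert (HSS : forall s, S s -> commutant S s).
  { intros s [Hs| ->] t [Ht| ->]; try reflexivity.
    - apply Hab; assumption.
    - symmetry. apply Hc, Hs.
    - apply Hc, Ht. }
  assert (Hstar : forall s, commutant S s -> commutant S (s^*)%A)
    by apply (commutant_star_subalgebra S HS).
  apply (Hmax (commutant (commutant S))).
  - apply commutant_star_subalgebra, Hstar.
  - intros y z Hy Hz. apply Hy. intros s Hs. apply Hz, HSS, Hs.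
  - intros m Hm s Hs. symmetry. apply Hs. left. exact Hm.
  - intros s Hs. symmetry. apply Hs. right. reflexivity.
Qed.

(** Self-adjointness is part of the relation, so that its cliques are commuting sets of self-adjoint
    elements. *)
Definition sa_commute x y : Prop := (x^* = x)%A /\ (y^* = y)%A /\ (x * y = y * x)%A.

(** The commutant of a maximal clique [S] is abelian: the Cartesian parts of its elements commute
    with [S], so they belong to [S]. Any abelian algebra containing it contains [S] and lies in that
    commutant. *)
Lemma masa_exists (S0 : A -> Prop) :
  (forall x y, S0 x -> S0 y -> sa_commute x y) ->
  exists M, is_masa A M /\ forall x, S0 x -> M x.
Proof.
  intros H0. destruct (maximal_clique A sa_commute S0 H0) as (S & HS0 & Hcl & Hmax).
  assert (Hsa : forall s, S s -> (s^* = s)%A) by (intros s Hs; apply (Hcl s s Hs Hs)).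
  assert (HM : star_subalgebra A (commutant S)).
  { apply commutant_star_subalgebra. intros s Hs. rewrite Hsa; exact Hs. }
  assert (Hin : forall x, (x^* = x)%A -> commutant S x -> S x).
  { intros x Hx Hc. apply Hmax; [repeat split; exact Hx|].
    intros y Hy. pose proof (Hsa y Hy). pose proof (Hc y Hy) as E.
    repeat split; try assumption. symmetry. exact E. }
  assert (HSM : forall x, S x -> commutant S x) by (intros x Hx s Hs; apply Hcl; assumption).
  exists (commutant S). split; [|intros x Hx; apply HSM, HS0, Hx].
  split; [exact HM|]. split.
  - intros x y Hx Hy. rewrite (hk_decomp x).
    rewrite cmul_addl, cmul_addr, cmul_smull, cmul_smulr.
    rewrite (Hy (hpart x)), (Hy (kpart x)); [reflexivity| |].
    + apply Hin; [apply kpart_sa | apply kpart_in; assumption].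
    + apply Hin; [apply hpart_sa | apply hpart_in; assumption].
  - intros N _ HN Hsub x Hx s Hs. apply HN; [exact Hx | apply Hsub, HSM, Hs].
Qed.

(** * The unitization of the self-adjoint part of a masa *)

Section Unitization.
Variable M : A -> Prop.
Hypothesis HM : is_masa A M.

Lemma masa_sub : star_subalgebra A M.
Proof. apply HM. Qed.

Lemma masa_comm x y : M x -> M y -> (x * y = y * x)%A.
Proof. apply HM. Qed.

Definition sa x : Prop := self_adjoint_in A M x.

Lemma sa_add x y : sa x -> sa y -> sa (x + y)%A.
Proof.
  intros [H1 H2] [H3 H4]. split; [apply masa_sub; assumption|].
  rewrite cstar_add, H2, H4. reflexivity.
Qed.

Lemma sa_rs r x : sa x -> sa (rs r x).
Proof.
  intros [H1 H2]. split; [apply masa_sub; assumption|]. rewrite cstar_rs, H2. reflexivity.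
Qed.

Lemma sa_mul x y : sa x -> sa y -> sa (x * y)%A.
Proof.
  intros [H1 H2] [H3 H4]. split; [apply masa_sub; assumption|].
  rewrite cstar_mul, H2, H4. apply masa_comm; assumption.
Qed.

Lemma sa_0 : sa 0%A.
Proof. split; [apply masa_sub | apply cstar_0]. Qed.

Lemma sa_opp x : sa x -> sa (- x)%A.
Proof. rewrite copp_rs. apply sa_rs. Qed.

Lemma sa_comm x y : sa x -> sa y -> (x * y = y * x)%A.
Proof. intros [H _] [H' _]. apply masa_comm; assumption. Qed.

(** The pair (b, r) stands for b + r 1. *)
Definition unitz : Type := {p : A * R | sa (fst p)}.
Definition alg (X : unitz) : A := fst (proj1_sig X).
Definition lam (X : unitz) : R := snd (proj1_sig X).
Definition mk b (r : R) (Hb : sa b) : unitz := exist _ (b, r) Hb.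

Lemma alg_sa X : sa (alg X).
Proof. apply (proj2_sig X). Qed.

Lemma unitz_eq X Y : alg X = alg Y -> lam X = lam Y -> X = Y.
Proof.
  destruct X as [[b r] Hb], Y as [[c s] Hc]. unfold alg, lam. simpl. intros -> ->.
  f_equal. apply proof_irrelevance.
Qed.

Definition uzero : unitz := mk 0%A 0 sa_0.
Definition uone : unitz := mk 0%A 1 sa_0.
Definition uadd X Y : unitz :=
  mk (alg X + alg Y)%A (lam X + lam Y) (sa_add _ _ (alg_sa X) (alg_sa Y)).
Definition uopp X : unitz := mk (- alg X)%A (- lam X) (sa_opp _ (alg_sa X)).
Definition usub X Y : unitz := uadd X (uopp Y).
Definition umul X Y : unitz :=
  mk (alg X * alg Y + (rs (lam X) (alg Y) + rs (lam Y) (alg X)))%A (lam X * lam Y)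
    (sa_add _ _ (sa_mul _ _ (alg_sa X) (alg_sa Y))
      (sa_add _ _ (sa_rs _ _ (alg_sa Y)) (sa_rs _ _ (alg_sa X)))).
Definition uscal (r : R) : unitz := mk 0%A r sa_0.

Lemma alg_umul X Y :
  alg (umul X Y) = (alg X * alg Y + (rs (lam X) (alg Y) + rs (lam Y) (alg X)))%A.
Proof. reflexivity. Qed.

Lemma umul_comm X Y : umul X Y = umul Y X.
Proof.
  apply unitz_eq; [|apply Rmult_comm]. rewrite !alg_umul.
  rewrite (sa_comm _ _ (alg_sa X) (alg_sa Y)). f_equal. apply cadd_comm.
Qed.

Lemma unitz_ring : ring_theory uzero uone uadd umul usub uopp eq.
Proof.
  constructor.
  - intros X. apply unitz_eq; [apply cadd_0l | apply Rplus_0_l].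
  - intros X Y. apply unitz_eq; [apply cadd_comm | apply Rplus_comm].
  - intros X Y Z. apply unitz_eq; [apply cadd_assoc | symmetry; apply Rplus_assoc].
  - intros X. apply unitz_eq; [|apply Rmult_1_l]. change (alg (umul uone X))
      with (0 * alg X + (rs 1 (alg X) + rs (lam X) 0))%A.
    rewrite cmul_0l, rs_zero, rs_1, cadd_0, cadd_0l. reflexivity.
  - apply umul_comm.
  - intros X Y Z. apply unitz_eq; [|symmetry; apply Rmult_assoc].
    change (alg X * (alg Y * alg Z + (rs (lam Y) (alg Z) + rs (lam Z) (alg Y)))
        + (rs (lam X) (alg Y * alg Z + (rs (lam Y) (alg Z) + rs (lam Z) (alg Y)))
           + rs (lam Y * lam Z) (alg X))
      = (alg X * alg Y + (rs (lam X) (alg Y) + rs (lam Y) (alg X))) * alg Z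
        + (rs (lam X * lam Y) (alg Z)
           + rs (lam Z) (alg X * alg Y + (rs (lam X) (alg Y) + rs (lam Y) (alg X)))))%A.
    expand.
    rewrite (Rmult_comm (lam Z) (lam X)), (Rmult_comm (lam Z) (lam Y)).
    permute.
  - intros X Y Z. apply unitz_eq; [|apply Rmult_plus_distr_r].
    change ((alg X + alg Y) * alg Z + (rs (lam X + lam Y) (alg Z) + rs (lam Z) (alg X + alg Y))
      = alg X * alg Z + (rs (lam X) (alg Z) + rs (lam Z) (alg X))
        + (alg Y * alg Z + (rs (lam Y) (alg Z) + rs (lam Z) (alg Y))))%A.
    rewrite rs_add. expand. permute.
  - reflexivity.
  - intros X. apply unitz_eq; [apply cadd_opp | apply Rplus_opp_r].
Qed.

(** * The unitization acting by multiplication, and its norm *)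

(** Multiplication by b + r makes sense on [A] itself, so norm estimates for the unitization reduce
    to estimates in [A]. *)
Definition act X c : A := (alg X * c + rs (lam X) c)%A.

Lemma act_sa X c : sa c -> sa (act X c).
Proof. intros Hc. apply sa_add; [apply sa_mul; [apply alg_sa|] | apply sa_rs]; exact Hc. Qed.

Lemma act_add X Y c : act (uadd X Y) c = (act X c + act Y c)%A.
Proof.
  unfold act. change (alg (uadd X Y)) with (alg X + alg Y)%A.
  change (lam (uadd X Y)) with (lam X + lam Y). rewrite rs_add. expand. permute.
Qed.

Lemma act_mul X Y c : act (umul X Y) c = act X (act Y c).
Proof.
  unfold act. change (lam (umul X Y)) with (lam X * lam Y).
  change (alg (umul X Y)) with (alg X * alg Y + (rs (lam X) (alg Y) + rs (lam Y) (alg X)))%A.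
  expand. permute.
Qed.

Lemma act_rs X r c : act X (rs r c) = rs r (act X c).
Proof. unfold act. rewrite rs_addr, rs_mulr, !rs_rs, (Rmult_comm r). reflexivity. Qed.

Lemma act_mulr X c d : act X (c * d)%A = (act X c * d)%A.
Proof. unfold act. rewrite cmul_addl, rs_mull, cmul_assoc. reflexivity. Qed.

Lemma act_sq X c : sa c -> (act X c * act X c = act (umul X X) c * c)%A.
Proof.
  intros Hc. rewrite <- act_mulr, (sa_comm c _ Hc (act_sa X c Hc)), act_mul.
  apply act_mulr.
Qed.

Lemma cnorm_act X c : cnorm (act X c) <= (cnorm (alg X) + Rabs (lam X)) * cnorm c.
Proof.
  unfold act. eapply Rle_trans; [apply cnorm_triangle|]. rewrite cnorm_rs.
  pose proof (cnorm_submult A (alg X) c). lra.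
Qed.

(* The operator norm of left multiplication by b + r on M_sa is only a seminorm when M has a
   unit; including |r| makes it a norm. *)
Definition unorm_set X (v : R) : Prop :=
  (exists c, sa c /\ cnorm c <= 1 /\ v = cnorm (act X c)) \/ v = Rabs (lam X).

Lemma unorm_bound X : bound (unorm_set X).
Proof.
  exists (cnorm (alg X) + Rabs (lam X)).
  pose proof (cnorm_nonneg A (alg X)) as H1. pose proof (Rabs_pos (lam X)) as H2.
  intros v [(c & _ & Hc & ->)| ->]; [|lra].
  eapply Rle_trans; [apply cnorm_act|].
  rewrite <- (Rmult_1_r (cnorm (alg X) + Rabs (lam X))) at 2.
  apply Rmult_le_compat_l; lra.
Qed.

Definition unorm X : R :=
  proj1_sig (completeness (unorm_set X) (unorm_bound X)
    (ex_intro _ (Rabs (lam X)) (or_intror eq_refl))).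

Lemma unorm_lub X : is_lub (unorm_set X) (unorm X).
Proof. unfold unorm. destruct completeness as [m Hm]. exact Hm. Qed.

Lemma unorm_lam X : Rabs (lam X) <= unorm X.
Proof. apply unorm_lub. right. reflexivity. Qed.

Lemma unorm_ge0 X : 0 <= unorm X.
Proof. eapply Rle_trans; [apply Rabs_pos | apply unorm_lam]. Qed.

Lemma unorm_act X c : sa c -> cnorm (act X c) <= unorm X * cnorm c.
Proof.
  intros Hc. destruct (Req_dec (cnorm c) 0) as [H|H].
  - rewrite H. apply cnorm_eq0 in H. rewrite H. unfold act.
    rewrite cmul_0r, rs_zero, cadd_0, cnorm_0. lra.
  - pose proof (cnorm_nonneg A c). assert (Hi : 0 < / cnorm c) by (apply Rinv_0_lt_compat; lra).
    assert (H1 : cnorm (act X (rs (/ cnorm c) c)) <= unorm X).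
    { apply unorm_lub. left. exists (rs (/ cnorm c) c). split; [apply sa_rs, Hc|].
      split; [|reflexivity]. rewrite cnorm_rs, Rabs_pos_eq, Rinv_l by lra. lra. }
    rewrite act_rs, cnorm_rs, Rabs_pos_eq in H1 by lra.
    apply Rmult_le_reg_l with (/ cnorm c); [exact Hi|].
    replace (/ cnorm c * (unorm X * cnorm c)) with (unorm X) by (field; lra). exact H1.
Qed.

Lemma unorm_le X K : (forall c, sa c -> cnorm (act X c) <= K * cnorm c) ->
  Rabs (lam X) <= K -> unorm X <= K.
Proof.
  intros H1 H2. apply unorm_lub. intros v [(c & Hsa & Hc & ->)| ->]; [|exact H2].
  eapply Rle_trans; [apply H1, Hsa|]. pose proof (Rabs_pos (lam X)).
  rewrite <- (Rmult_1_r K) at 2. apply Rmult_le_compat_l; lra.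
Qed.

Lemma unorm_le_sum X : unorm X <= cnorm (alg X) + Rabs (lam X).
Proof.
  apply unorm_le; [intros c _; apply cnorm_act|]. pose proof (cnorm_nonneg A (alg X)). lra.
Qed.

(** Test the action on b = [alg X] itself: b^2 = X b - r b, and |b^2| = |b|^2. With [unorm_le_sum]
    this makes [unorm] equivalent to |b| + |r|, which yields completeness. *)
Lemma cnorm_alg_le X : cnorm (alg X) <= unorm X + Rabs (lam X).
Proof.
  destruct (Req_dec (cnorm (alg X)) 0) as [H|H].
  - rewrite H. pose proof (unorm_ge0 X). pose proof (Rabs_pos (lam X)). lra.
  - pose proof (cnorm_nonneg A (alg X)). apply Rmult_le_reg_r with (cnorm (alg X)); [lra|].
    rewrite <- cnorm_sa_sq by apply alg_sa.
    replace (alg X * alg X)%A with (act X (alg X) + rs (- lam X) (alg X))%A.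
    + eapply Rle_trans; [apply cnorm_triangle|]. rewrite cnorm_rs, Rabs_Ropp.
      pose proof (unorm_act X (alg X) (alg_sa X)). lra.
    + unfold act. rewrite <- cadd_assoc, <- rs_add, Rplus_opp_r, rs_0. apply cadd_0.
Qed.

Lemma unorm_eq0 X : unorm X = 0 -> X = uzero.
Proof.
  intros H. pose proof (unorm_lam X) as H1. pose proof (cnorm_alg_le X) as H2.
  pose proof (Rabs_pos (lam X)). pose proof (cnorm_nonneg A (alg X)).
  apply unitz_eq.
  - apply cnorm_eq0. lra.
  - change (lam X = 0). destruct (Req_dec (lam X) 0) as [|Hn]; [assumption|].
    apply Rabs_pos_lt in Hn. lra.
Qed.

Lemma unorm_triangle X Y : unorm (uadd X Y) <= unorm X + unorm Y.
Proof.
  apply unorm_le.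
  - intros c Hc. rewrite act_add. eapply Rle_trans; [apply cnorm_triangle|].
    pose proof (unorm_act X c Hc). pose proof (unorm_act Y c Hc). lra.
  - eapply Rle_trans; [apply (Rabs_triang (lam X) (lam Y))|].
    pose proof (unorm_lam X). pose proof (unorm_lam Y). lra.
Qed.

Lemma unorm_mul X Y : unorm (umul X Y) <= unorm X * unorm Y.
Proof.
  apply unorm_le.
  - intros c Hc. rewrite act_mul. eapply Rle_trans; [apply unorm_act, act_sa, Hc|].
    rewrite Rmult_assoc. apply Rmult_le_compat_l; [apply unorm_ge0 | apply unorm_act, Hc].
  - change (lam (umul X Y)) with (lam X * lam Y). rewrite Rabs_mult.
    apply Rmult_le_compat; try apply Rabs_pos; apply unorm_lam.
Qed.

Lemma unorm_scal r : unorm (uscal r) <= Rabs r.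
Proof.
  eapply Rle_trans; [apply unorm_le_sum|]. change (alg (uscal r)) with (0%A).
  change (lam (uscal r)) with r. rewrite cnorm_0. lra.
Qed.

(** For each vector c, |X c|^2 <= |(X c)^2 + (Y c)^2|, and the right side is the norm of ((X^2 +
    Y^2) c) c, at most D |c|^2. *)
Lemma unorm_sq X Y : unorm X * unorm X <= unorm (uadd (umul X X) (umul Y Y)).
Proof.
  set (D := unorm (uadd (umul X X) (umul Y Y))).
  assert (HD : 0 <= D) by apply unorm_ge0.
  assert (H : unorm X <= sqrt D).
  { apply unorm_le.
    - intros c Hc. pose proof (cnorm_nonneg A c) as Hc0.
      apply Rsqr_incr_0; [|apply cnorm_nonneg | apply Rmult_le_pos; [apply sqrt_pos | exact Hc0]].
      unfold Rsqr. replace (sqrt D * cnorm c * (sqrt D * cnorm c))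
        with (sqrt D * sqrt D * cnorm c * cnorm c) by ring.
      rewrite sqrt_sqrt by exact HD.
      pose proof (act_sa X c Hc) as HX. pose proof (act_sa Y c Hc) as HY.
      eapply Rle_trans; [apply (cnorm_sq_le _ (act Y c))|].
      + apply HX.
      + apply HY.
      + apply sa_comm; assumption.
      + rewrite !act_sq, <- cmul_addl, <- act_add by exact Hc.
        eapply Rle_trans; [apply cnorm_submult|].
        apply Rmult_le_compat_r; [exact Hc0 | apply unorm_act, Hc].
    - rewrite <- sqrt_Rsqr_abs. apply sqrt_le_1_alt.
      eapply Rle_trans; [|apply unorm_lam].
      change (lam (uadd (umul X X) (umul Y Y))) with (lam X * lam X + lam Y * lam Y).
      unfold Rsqr. rewrite Rabs_pos_eq by nra. nra. }
  pose proof (unorm_ge0 X). rewrite <- (sqrt_sqrt D HD). apply Rmult_le_compat; assumption.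
Qed.

(** Closedness comes from maximality: a limit is self-adjoint and commutes with M, so [masa_mem]
    applies. *)
Lemma masa_closed (u : nat -> A) l : (forall n, sa (u n)) ->
  (forall eps, 0 < eps -> exists n, cnorm (u n - l)%A < eps) -> sa l.
Proof.
  intros Hu Hl.
  assert (Hstar : (l^* = l)%A).
  { apply csub_eq0, cnorm_small. intros eps Heps.
    destruct (Hl (eps / 2) ltac:(lra)) as [n Hn].
    eapply Rle_trans; [apply (cdist_triangle _ (u n))|].
    replace (l^* - u n)%A with ((l - u n)^*)%A.
    - rewrite cnorm_star, cdistC. lra.
    - rewrite !copp_rs, cstar_add, cstar_rs. f_equal. f_equal. apply Hu. }
  split; [|exact Hstar]. apply (masa_mem M l HM Hstar). intros m Hm.
  apply csub_eq0, cnorm_small. intros eps Heps.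
  pose proof (cnorm_nonneg A m) as Hm0.
  destruct (Hl (eps / (2 * (cnorm m + 1)))) as [n Hn].
  { apply Rdiv_lt_0_compat; lra. }
  eapply Rle_trans; [apply (cdist_triangle _ (u n * m)%A)|].
  rewrite (masa_comm (u n) m (proj1 (Hu n)) Hm) at 2.
  rewrite <- csub_mull, <- csub_mulr.
  pose proof (cnorm_submult A (l - u n)%A m) as H1.
  pose proof (cnorm_submult A m (u n - l)%A) as H2. rewrite (cdistC l) in *.
  assert (H3 : cnorm (u n - l)%A * cnorm m <= eps / (2 * (cnorm m + 1)) * (cnorm m + 1)).
  { apply Rmult_le_compat; try apply cnorm_nonneg; lra. }
  replace (eps / (2 * (cnorm m + 1)) * (cnorm m + 1)) with (eps / 2) in H3 by (field; lra).
  lra.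
Qed.

Lemma unitz_complete (u : nat -> unitz) :
  (forall eps, 0 < eps -> exists N, forall m n, (N <= m)%nat -> (N <= n)%nat ->
     unorm (usub (u m) (u n)) < eps) ->
  exists l, forall eps, 0 < eps -> exists N, forall n, (N <= n)%nat ->
     unorm (usub (u n) l) < eps.
Proof.
  intros Hu.
  destruct (R_complete (fun n => lam (u n))) as [r Hr].
  { intros eps Heps. destruct (Hu eps Heps) as [N HN]. exists N. intros n m Hn Hm.
    eapply Rle_lt_trans; [|apply (HN n m Hn Hm)]. apply (unorm_lam (usub (u n) (u m))). }
  destruct (ccomplete A (fun n => alg (u n))) as [b Hb].
  { intros eps Heps. destruct (Hu (eps / 2) ltac:(lra)) as [N HN]. exists N.
    intros m n Hm Hn. specialize (HN m n Hm Hn).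
    pose proof (cnorm_alg_le (usub (u m) (u n))) as H1.
    pose proof (unorm_lam (usub (u m) (u n))) as H2.
    change (alg (usub (u m) (u n))) with (alg (u m) - alg (u n))%A in H1. lra. }
  assert (Hsb : sa b).
  { apply (masa_closed (fun n => alg (u n))); [intros n; apply alg_sa|].
    intros eps Heps. destruct (Hb eps Heps) as [N HN]. exists N. apply HN, le_n. }
  exists (mk b r Hsb). intros eps Heps.
  destruct (Hb (eps / 2) ltac:(lra)) as [N1 HN1].
  destruct (Hr (eps / 2) ltac:(lra)) as [N2 HN2].
  exists (max N1 N2). intros n Hn.
  specialize (HN1 n ltac:(lia)). specialize (HN2 n ltac:(lia)). unfold Rdist in HN2.
  eapply Rle_lt_trans; [apply unorm_le_sum|].
  change (alg (usub (u n) (mk b r Hsb))) with (alg (u n) - b)%A.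
  change (lam (usub (u n) (mk b r Hsb))) with (lam (u n) - r). lra.
Qed.

Definition unitization : AugAlgebra.
Proof.
  refine {| aug := unitz; aug_ring := unitz_ring; scal := uscal; nm := unorm;
    nm_ge0 := unorm_ge0; nm_eq0 := unorm_eq0; nm_triangle := unorm_triangle;
    nm_mul := unorm_mul; nm_scal := unorm_scal; nm_sq := unorm_sq;
    aug_complete := unitz_complete; chi := lam; chi_nm := unorm_lam |}.
  - intros r s. apply unitz_eq; [symmetry; apply cadd_0 | reflexivity].
  - intros r s. apply unitz_eq; [|reflexivity].
    change (0 = 0 * 0 + (rs r 0 + rs s 0))%A. rewrite cmul_0l, !rs_zero, !cadd_0. reflexivity.
  - reflexivity.
  - reflexivity.
  - reflexivity.
  - reflexivity.
Defined.

(** * Translation between a masa and its unitization *)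

Lemma alg_umul_lam0 X Y : lam X = 0 ->
  alg (umul X Y) = (alg X * alg Y + rs (lam Y) (alg X))%A.
Proof. intros H. rewrite alg_umul, H, rs_0, cadd_0l. reflexivity. Qed.

(** A root of c - b has scalar part of square 0, so it lies in M; conversely w* w is the sum of the
    squares of the Cartesian parts of w. *)
Lemma ale_le_in b c (Hb : sa b) (Hc : sa c) :
  ale unitization (mk b 0 Hb) (mk c 0 Hc) <-> le_in A M b c.
Proof.
  split.
  - intros [Y HY]. exists (alg Y). split; [apply alg_sa|].
    assert (Hl : lam Y = 0).
    { apply (f_equal lam) in HY. change (0 + - 0 = lam Y * lam Y) in HY. nra. }
    apply (f_equal alg) in HY.
    change (c - b = alg Y * alg Y + (rs (lam Y) (alg Y) + rs (lam Y) (alg Y)))%A in HY.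
    rewrite Hl, rs_0, !cadd_0 in HY. rewrite HY. f_equal. symmetry. apply alg_sa.
  - intros (w & Hw & Hcb).
    pose proof (hpart_in M w masa_sub Hw) as Hh. pose proof (kpart_in M w masa_sub Hw) as Hk.
    assert (Hsh : sa (hpart w)) by (split; [exact Hh | apply hpart_sa]).
    assert (Hsk : sa (kpart w)) by (split; [exact Hk | apply kpart_sa]).
    set (H := mk (hpart w) 0 Hsh : unitization). set (K := mk (kpart w) 0 Hsk : unitization).
    unfold ale.
    replace (asub (mk c 0 Hc : unitization) (mk b 0 Hb : unitization))
      with (aadd (amul H H) (amul K K)).
    + apply pos_add; apply pos_sq.
    + apply unitz_eq.
      * change (alg (umul H H) + alg (umul K K) = c - b)%A.
        rewrite !alg_umul_lam0 by reflexivity.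
        change (hpart w * hpart w + rs 0 (hpart w) + (kpart w * kpart w + rs 0 (kpart w))
          = c - b)%A.
        pose proof (hk_sq (hpart w) (kpart w) (hpart_sa w) (kpart_sa w)
          (masa_comm _ _ Hh Hk)) as E.
        rewrite <- hk_decomp in E. rewrite !rs_0, !cadd_0, Hcb, E. reflexivity.
      * change (0 * 0 + 0 * 0 = 0 + - 0). ring.
Qed.

(** For m in M, b(m e - m) = m(b e - b) = 0, so e m e = e m. The adjoint of this relation for m* is
    e m e = m e, so e commutes with M. *)
Lemma ARP_in_masa b e : sa b -> is_ARP A b e -> sa e.
Proof.
  intros [Hb Hbs] ((Hes & Hee) & Hbe & Hann). split; [|exact Hes].
  assert (H : forall m, M m -> (e * m * e = e * m)%A).
  { intros m Hm. apply csub_eq0. rewrite <- (cmul_assoc A e m e), <- csub_mulr.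
    apply Hann. rewrite csub_mulr, !cmul_assoc, (masa_comm b m Hb Hm), <- cmul_assoc, Hbe.
    apply cadd_opp. }
  apply (masa_mem M e HM Hes). intros m Hm.
  rewrite <- (H m Hm). pose proof (H (m^*)%A) as H1.
  apply (f_equal cstar) in H1; [|apply masa_sub, Hm].
  rewrite !cstar_mul, cstar_invol, Hes, cmul_assoc in H1. exact H1.
Qed.

Lemma masa_sigma_complete : weakly_Rickart A -> monotone_sigma_complete A M.
Proof.
  intros HW u Hu [K HK] Hinc.
  assert (HARP : forall X : unitization, chi X = 0%R -> exists E, aug_ARP unitization X E).
  { intros X HX. change (lam X = 0%R) in HX. destruct (HW (alg X)) as [e He].
    pose proof (ARP_in_masa _ _ (alg_sa X) He) as Hse.
    destruct He as ((_ & Hee) & Hbe & Hann).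
    exists (mk e 0 Hse). split; [reflexivity|]. split; [|split].
    - apply unitz_eq; [|apply Rmult_0_l]. apply (eq_trans (alg_umul_lam0 (mk e 0 Hse) (mk e 0 Hse) eq_refl)).
      change (e * e + rs 0 e = e)%A. rewrite rs_0, cadd_0. exact Hee.
    - apply unitz_eq; [|rewrite HX; apply Rmult_0_r].
      apply (eq_trans (alg_umul_lam0 _ _ HX)).
      change (alg X * e + rs 0 (alg X) = alg X)%A. rewrite rs_0, cadd_0. exact Hbe.
    - intros Y HY. apply (f_equal alg) in HY.
      pose proof (eq_trans (eq_sym (alg_umul_lam0 X Y HX)) HY) as HY'.
      apply unitz_eq; [|apply Rmult_0_l]. apply (eq_trans (alg_umul_lam0 (mk e 0 Hse) Y eq_refl)).
      change (e * alg Y + rs (lam Y) e = 0)%A.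
      (* The scalar part is absorbed into [A]: as b e = b, the hypothesis says that b annihilates
         alg Y + lam Y e, to which [Hann] applies. *)
      rewrite <- Hee at 2. rewrite <- rs_mulr, <- cmul_addr. apply Hann.
      rewrite cmul_addr, rs_mulr, Hbe. exact HY'. }
  destruct (aug_sigma_complete_of_ARP unitization HARP (fun n => mk (u n) 0 (Hu n)))
    as (S & HS & Hub & Hl).
  - reflexivity.
  - exists K. intros n. eapply Rle_trans; [apply unorm_le_sum|].
    change (cnorm (u n) + Rabs 0 <= K). rewrite Rabs_R0. specialize (HK n). lra.
  - intros n. apply ale_le_in, Hinc.
  - change (lam S = 0%R) in HS.
    assert (ES : S = mk (alg S) 0 (alg_sa S)) by (apply unitz_eq; [reflexivity | exact HS]).
    rewrite ES in Hub, Hl.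
    exists (alg S). split; [apply alg_sa|]. split.
    + intros n. apply (ale_le_in _ _ (Hu n) (alg_sa S)), Hub.
    + intros t Ht Htu. apply (ale_le_in _ _ (alg_sa S) Ht), Hl; [reflexivity|].
      intros n. apply ale_le_in, Htu.
Qed.

(** Annihilation is controlled only inside the masa; extending it to all of [A] depends on a
    suitable choice of masa. *)
Lemma ARP_within_masa b : monotone_sigma_complete A M -> sa b ->
  exists e, sa e /\ (e * e = e)%A /\ (b * e = b)%A /\
    forall s, sa s -> (b * s = 0)%A -> (e * s = 0)%A.
Proof.
  intros Hsc Hb.
  destruct (aug_ARP_of_sigma_complete unitization (mk b 0 Hb)) as (E & HE & HEE & HbE & Hann).
  - reflexivity.
  - intros u Hu [K HK] Hinc.
    assert (Eu : forall n, u n = mk (alg (u n)) 0 (alg_sa (u n))).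
    { intros n. apply unitz_eq; [reflexivity | apply (Hu n)]. }
    destruct (Hsc (fun n => alg (u n))) as (s & Hs & Hub & Hl).
    + intros n. apply alg_sa.
    + exists K. intros n. eapply Rle_trans; [apply cnorm_alg_le|].
      specialize (Hu n). change (lam (u n) = 0%R) in Hu. rewrite Hu, Rabs_R0, Rplus_0_r.
      apply HK.
    + intros n. specialize (Hinc n). rewrite (Eu n), (Eu (S n)) in Hinc.
      apply ale_le_in in Hinc. exact Hinc.
    + exists (mk s 0 Hs). split; [reflexivity|]. split.
      * intros n. rewrite (Eu n). apply ale_le_in, Hub.
      * intros t Ht Htu. change (lam t = 0%R) in Ht.
        assert (Et : t = mk (alg t) 0 (alg_sa t)) by (apply unitz_eq; [reflexivity | exact Ht]).
        rewrite Et. apply ale_le_in, Hl; [apply alg_sa|]. intros n.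
        specialize (Htu n). rewrite (Eu n), Et in Htu. apply ale_le_in in Htu. exact Htu.
  - change (lam E = 0%R) in HE. exists (alg E). split; [apply alg_sa|]. split; [|split].
    + apply (f_equal alg) in HEE.
      pose proof (eq_trans (eq_sym (alg_umul_lam0 E E HE)) HEE) as H.
      rewrite HE, rs_0, cadd_0 in H. exact H.
    + apply (f_equal alg) in HbE.
      pose proof (eq_trans (eq_sym (alg_umul_lam0 (mk b 0 Hb) E eq_refl)) HbE) as H.
      rewrite HE, rs_0, cadd_0 in H. exact H.
    + intros s Hs Hbs. specialize (Hann (mk s 0 Hs)).
      assert (H0 : umul (mk b 0 Hb) (mk s 0 Hs) = uzero).
      { apply unitz_eq; [|apply Rmult_0_l]. rewrite alg_umul_lam0 by reflexivity.
        change (b * s + rs 0 b = 0)%A. rewrite rs_0, cadd_0. exact Hbs. }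
      apply Hann, (f_equal alg) in H0.
      pose proof (eq_trans (eq_sym (alg_umul_lam0 E (mk s 0 Hs) HE)) H0) as H.
      change (alg E * s + rs 0 (alg E) = 0)%A in H. rewrite rs_0, cadd_0 in H. exact H.
Qed.

End Unitization.

(* Let b = x* x and let S be a maximal commuting set of self-adjoint elements annihilated by b.
   In a masa containing S and b, let e be the annihilating projection of b; it kills S.
   If x y = 0 then e y y* e commutes with S and is annihilated by b, so it belongs to S
   and is therefore killed by e, i.e. y* e = 0. *)
Lemma weakly_Rickart_of_masas :
  (forall M, is_masa A M -> monotone_sigma_complete A M) -> weakly_Rickart A.
Proof.
  intros H x. set (b := (x^* * x)%A).
  assert (Hb : (b^* = b)%A) by (unfold b; rewrite cstar_mul, cstar_invol; reflexivity).
  (* Annihilation by [b] is built into the relation, so [S] is maximal among commuting sets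
     annihilated by [b], not among all commuting sets. *)
  destruct (maximal_clique A (fun s t => sa_commute s t /\ (b * s = 0)%A /\ (b * t = 0)%A)
    (fun _ => False)) as (S & _ & Hcl & Hmax); [tauto|].
  assert (HS : forall s, S s -> (s^* = s)%A /\ (b * s = 0)%A /\ (s * b = 0)%A).
  { intros s Hs. destruct (Hcl s s Hs Hs) as ((Hss & _) & Hbs & _).
    split; [exact Hss|]. split; [exact Hbs|].
    rewrite <- Hss, <- Hb, <- cstar_mul, Hbs. apply cstar_0. }
  destruct (masa_exists (fun s => S s \/ s = b)) as (M & HM & HSM).
  { intros s t [Hs| ->] [Ht| ->].
    - apply (Hcl s t Hs Ht).
    - destruct (HS s Hs) as (H1 & H2 & H3). split; [exact H1|]. split; [exact Hb|].
      rewrite H2, H3. reflexivity.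
    - destruct (HS t Ht) as (H1 & H2 & H3). split; [exact Hb|]. split; [exact H1|].
      rewrite H2, H3. reflexivity.
    - repeat split; exact Hb. }
  destruct (ARP_within_masa M HM b (H M HM)) as (e & (_ & Hes) & Hee & Hbe & Hann).
  { split; [apply HSM; right; reflexivity | exact Hb]. }
  assert (HeS : forall s, S s -> (e * s = 0)%A /\ (s * e = 0)%A).
  { intros s Hs. destruct (HS s Hs) as (H1 & H2 & _).
    assert (H3 : (e * s = 0)%A) by (apply Hann; [split; [apply HSM; left|]|]; assumption).
    split; [exact H3|]. rewrite <- H1, <- Hes, <- cstar_mul, H3. apply cstar_0. }
  exists e. split; [split; assumption|]. split.
  (* The square (x e - x)* (x e - x) is expressed through b = x* x and vanishes by b e = b. *)
  - apply csub_eq0, cstar_sq_eq0.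
    rewrite csub_mulr, !cmul_assoc, copp_rs, cstar_add, cstar_rs, cstar_mul, Hes, <- copp_rs.
    rewrite !csub_mull, <- (cmul_assoc A e (x^*)%A x). fold b.
    rewrite <- (cmul_assoc A e b e), Hbe. apply cadd_opp.
  - intros y Hxy. set (z := (y^* * e)%A). set (c := (z^* * z)%A).
    assert (Hz : (z^* = e * y)%A) by (unfold z; rewrite cstar_mul, cstar_invol, Hes; reflexivity).
    assert (Hc : (c^* = c)%A) by (unfold c; rewrite cstar_mul, cstar_invol; reflexivity).
    assert (Hec : (e * c = c)%A) by (unfold c; rewrite Hz, !cmul_assoc, Hee; reflexivity).
    assert (Hce : (c * e = c)%A) by (unfold c, z; rewrite <- !cmul_assoc, Hee; reflexivity).
    assert (Hbc : (b * c = 0)%A).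
    { unfold c. rewrite Hz, !cmul_assoc, Hbe. unfold b.
      rewrite <- (cmul_assoc A (x^*)%A x y), Hxy, cmul_0r. apply cmul_0l. }
    assert (HSc : S c).
    (* [c] commutes with [S] because all these products are zero: e c = c = c e, and e kills [S] on
       both sides. *)
    { apply Hmax; [repeat split; assumption|]. intros s Hs.
      destruct (HS s Hs) as (H1 & H2 & _). destruct (HeS s Hs) as (H3 & H4).
      assert (H5 : (c * s = 0)%A) by (rewrite <- Hce, <- cmul_assoc, H3; apply cmul_0r).
      assert (H6 : (s * c = 0)%A) by (rewrite <- Hec, cmul_assoc, H4; apply cmul_0l).
      repeat split; try assumption; rewrite H5, H6; reflexivity. }
    assert (Hz0 : z = 0%A).
    { apply cstar_sq_eq0. fold c. rewrite <- Hec. apply (HeS c HSc). }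
    rewrite <- Hz, Hz0. apply cstar_0.
Qed.

End CStar.

Theorem theorem3p8 (A : CStarAlgebra) :
  weakly_Rickart A <->
  (forall M : A -> Prop, is_masa A M -> monotone_sigma_complete A M).
Proof.
  split.
  - intros HW M HM. exact (masa_sigma_complete A M HM HW).
  - apply weakly_Rickart_of_masas.
Qed.
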